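(* Let $X\subseteq\{0,1\}^{\mathbb Z}$ be a sandwich measure-theoretically subordinate subshift with base measure $\rho$ such that $h(\rho)=0$ (entropy with respect to $\sigma\times\sigma$), and let $\varphi\colon X\to\mathbb R$ be of the form $\varphi(x)=\varphi(x_0)$. Then \[ \mathcal P_{X,\varphi}=\rho(0,0)\varphi(0)+\rho(1,1)\varphi(1)+\rho(0,1)\log_2\big(2^{\varphi(0)}+2^{\varphi(1)}\big), \] where $\rho(a,b)=\rho(\{(w,x):w_0=a,\ x_0=b\})$, and there is a unique equilibrium state, namely $N_*(\rho\otimes B_p)$ with $p=2^{\varphi(0)}/(2^{\varphi(0)}+2^{\varphi(1)})$. In particular (taking $\varphi\equiv0$), $h_{top}(X)=\rho(0,1)=\nu_1(1)-\nu_0(1)$, where $\nu_0,\nu_1$ are the marginals of $\rho$, $X$ is intrinsically ergodic, and $N_*(\rho\otimes B_{1/2})$ is its unique measure of maximal entropy.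
   Context: $\sigma$ is the left shift on $\{0,1\}^{\mathbb Z}$; $\mathcal M(Y)$ is the set of shift-invariant Borel probability measures on $Y$; $\nu(1)=\nu(\{x:x_0=1\})$. $B_p$ is the Bernoulli measure on $\{0,1\}^{\mathbb Z}$ with probability $p$ of $0$ and $1-p$ of $1$. Topological pressure: $\mathcal P_{X,\varphi}=\lim_n\frac1n\log_2\sum_{A\in\mathcal L_n(X)}2^{\sup_{x\in A}\varphi^{(n)}(x)}$ with $\mathcal L_n(X)$ the $n$-blocks of $X$ and $\varphi^{(n)}=\sum_{j<n}\varphi\circ\sigma^j$; it equals $\sup_{\mu\in\mathcal M(X)}(h(\mu)+\int\varphi\,d\mu)$ (entropy base 2), and an equilibrium state is a maximizer. $N(w,x,y)=(1-y)w+yx$ coordinatewise, $\pi_{1,2}$ the projection to the first two coordinates. A subshift $X$ is a sandwich measure-theoretically subordinate subshift if there is $\rho\in\mathcal M((\{0,1\}^{\mathbb Z})^2,\sigma\times\sigma)$ with $\mathcal M(X)=\{N_*(\lambda):\lambda\in\mathcal M((\{0,1\}^{\mathbb Z})^3,\sigma^{\times3}),(\pi_{1,2})_*\lambda=\rho\}$; $\rho$ is a base measure if moreover $\rho(\{(w,x):w\le x\text{ coordinatewise}\})=1$. *)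

(* Defs.v *)
From HB Require Import structures.
From mathcomp Require Import all_boot all_order all_algebra.
From mathcomp Require Import all_classical all_reals all_analysis.
Set Implicit Arguments. Unset Strict Implicit. Unset Printing Implicit Defensive.
Import Order.TTheory GRing.Theory Num.Theory numFieldNormedType.Exports.
Local Open Scope classical_set_scope.
Local Open Scope ring_scope.

(* finite alphabets that are also pointed (needed for g_sigma_algebraType) *)
HB.structure Definition PFin := {T of Finite T & isPointed T}.
HB.saturate bool.
HB.saturate prod.

Definition shift {A : Type} (x : int -> A) : int -> A := fun i => x (i + 1).

Definition win {A : Type} (x : int -> A) (m : int) (n : nat) : seq A :=
  [seq x (m + i%:Z) | i <- iota 0 n].

Definition cyl {A : Type} (m : int) (u : seq A) : set (int -> A) :=
  [set x | win x m (size u) = u].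

Definition cylinders (A : Type) : set (set (int -> A)) :=
  [set C | exists m u, C = cyl m u].

Definition ShiftSpace (A : PFin.type) := g_sigma_algebraType (@cylinders A).

(* subshift: nonempty, closed (product topology), shift-invariant *)
Definition subshift (X : set (int -> bool)) : Prop :=
  [/\ X !=set0,
      shift @` X = X &
      (forall x, (forall n : nat, exists2 y, X y &
          win y (- n%:Z) n.*2.+1 = win x (- n%:Z) n.*2.+1) -> X x)].

Notation Bool2 := (bool * bool)%type.
Notation Bool3 := ((bool * bool) * bool)%type.

Section Defs.
Variable R : realType.

Definition log2 (t : R) : R := ln t / ln 2.

Definition invariant (A : PFin.type) (mu : probability (ShiftSpace A) R) : Prop :=
  forall B : set (ShiftSpace A), measurable B -> mu (shift @^-1` B) = mu B.

Definition inM (X : set (int -> bool)) (mu : probability (ShiftSpace bool) R) : Prop :=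
  invariant mu /\ mu X = 1%E.

Definition meq (A : PFin.type) (mu : probability (ShiftSpace A) R)
  (nu : set (ShiftSpace A) -> \bar R) : Prop :=
  forall B : set (ShiftSpace A), measurable B -> mu B = nu B.

(* Kolmogorov-Sinai entropy (base 2) w.r.t. the generating time-zero partition *)
Definition xlog2x (t : R) : R := if t == 0 then 0 else t * log2 t.
Definition blockH (A : PFin.type) (mu : probability (ShiftSpace A) R) (n : nat) : R :=
  - \sum_(u : n.-tuple A) xlog2x (fine (mu (cyl 0 (tval u)))).
Definition entropy (A : PFin.type) (mu : probability (ShiftSpace A) R) : R :=
  limn (fun n : nat => blockH mu n / n%:R).

Definition inL (X : set (int -> bool)) (n : nat) (u : n.-tuple bool) : bool :=
  `[< exists2 x, X x & win x 0 n = tval u >].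

Definition pressure (X : set (int -> bool)) (phi : (int -> bool) -> R) : R :=
  limn (fun n : nat =>
    log2 (\sum_(u : n.-tuple bool | inL X u)
       (2 : R) `^ (sup [set (\sum_(j < n) phi (iter j shift x)) |
                         x in X `&` cyl 0 (tval u)])) / n%:R).

Definition htop (X : set (int -> bool)) : R :=
  limn (fun n : nat => log2 (#|[pred u : n.-tuple bool | inL X u]|)%:R / n%:R).

Definition integ (mu : probability (ShiftSpace bool) R) (phi : (int -> bool) -> R) : R :=
  fine (\int[mu]_x (phi x)%:E)%E.

Definition equilibrium (X : set (int -> bool)) (phi : (int -> bool) -> R)
  (mu : probability (ShiftSpace bool) R) : Prop :=
  inM X mu /\ forall nu, inM X nu -> entropy nu + integ nu phi <= entropy mu + integ mu phi.

Definition mme (X : set (int -> bool)) (mu : probability (ShiftSpace bool) R) : Prop :=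
  inM X mu /\ forall nu, inM X nu -> entropy nu <= entropy mu.

Definition intrinsically_ergodic (X : set (int -> bool)) : Prop :=
  (exists mu, mme X mu) /\ forall mu nu, mme X mu -> mme X nu -> meq mu nu.

(* the maps N and pi_{1,2}; a triple (w,x,y) is encoded as a sequence over ((bool*bool)*bool) *)
Definition Nmap (z : ShiftSpace Bool3) : ShiftSpace bool :=
  fun i => if (z i).2 then (z i).1.2 else (z i).1.1.
Definition pi12 (z : ShiftSpace Bool3) : ShiftSpace Bool2 :=
  fun i => (z i).1.
Definition fstm (z : ShiftSpace Bool2) : ShiftSpace bool := fun i => (z i).1.
Definition sndm (z : ShiftSpace Bool2) : ShiftSpace bool := fun i => (z i).2.

Definition sandwich (X : set (int -> bool)) (rho : probability (ShiftSpace Bool2) R) : Prop :=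
  invariant rho /\
  forall mu : probability (ShiftSpace bool) R,
    inM X mu <->
    exists lam : probability (ShiftSpace Bool3) R,
      [/\ invariant lam,
          meq rho (pushforward lam pi12) &
          meq mu (pushforward lam Nmap)].

Definition base_measure (rho : probability (ShiftSpace Bool2) R) : Prop :=
  rho [set z | forall i, (z i).1 ==> (z i).2] = 1%E.

Definition bern_cyl (p : R) (u : seq bool) : R :=
  \prod_(b <- u) (if b then 1 - p else p).

Definition is_prod_bern (rho : probability (ShiftSpace Bool2) R) (p : R)
  (lam : probability (ShiftSpace Bool3) R) : Prop :=
  forall (m : int) (u : seq Bool3),
    lam (cyl m u) = (rho (cyl m (map fst u)) * (bern_cyl p (map snd u))%:E)%E.

Definition rho2 (rho : probability (ShiftSpace Bool2) R) (a b : bool) : R :=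
  fine (rho (cyl 0 [:: (a, b)])).

End Defs.

Arguments htop {R} X.
Arguments intrinsically_ergodic {R} X.

(* Main.v *)
Require Import Defs.
From HB Require Import structures.
From mathcomp Require Import all_boot all_order all_algebra.
From mathcomp Require Import all_classical all_reals all_analysis.
From mathcomp Require Import measurable_realfun ring lra zify.
Import Order.TTheory GRing.Theory Num.Theory numFieldNormedType.Exports.
(* Imported again: MathComp also defines [shift] and [invariant]. *)
Require Import Defs.
Set Implicit Arguments. Unset Strict Implicit. Unset Printing Implicit Defensive.
Local Open Scope classical_set_scope.
Local Open Scope ring_scope.

(** A measure in [M(X)] is the image [z = N(w, x, y)] of an invariant law of
    [(w, x, y)]. Gibbs' inequality, applied to the words of length [n] of
    [(w, x, z)] and to the law of [(w, x, N(w, x, y))] under [rho (x) B_p], gives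
    [H_n(w, x, z) + n \int phi <= H_n(rho) + n P], where [P] is the right-hand
    side of the pressure formula. As [H_n(rho) = o(n)], this bounds
    [h(mu) + \int phi] by [P]. The conditional entropy
    [H_n(w, x, z) - H_n(rho)] is subadditive, so equality in the limit forces
    equality in Gibbs' inequality for every [n], hence uniqueness; conversely
    [rho (x) B_p] attains the bound because [H_n(w, x, z) <= H_n(z) + H_n(rho)].
    For the pressure, the empirical word frequencies of the Gibbs weights on
    [L_n(X)] converge along an ultrafilter to an invariant measure on [X] whose
    free energy dominates the exponential growth rate of the partition
    functions. *)

(** * Sums over words *)

(** The triple [(w, x, y)] is recoded as [(w, x, z)] because [N] forgets [y] wherever [w] and [x]
    agree. There the conditional law of [z] is a point mass; where [w = 0] and [x = 1] it is the
    coin [B_p], whose bias makes [log2] of the probability of a letter equal to [phi] minus a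
    constant. Cross entropy plus energy then depends on the joining only through [rho], so Gibbs'
    inequality gives one bound for all of [M(X)].

    The obstacle for the pressure is that the Gibbs weights on [L_n(X)] are not shift-invariant, so
    their entropies are not block entropies of the limit measure. They are compared with a Markov
    measure of order [k] built from the limit law itself: that cross entropy is linear in the
    frequencies of words of length [k + 1], up to a boundary term, hence passes to the limit, and
    what remains is the increment of block entropy from [k] to [k + 1], which telescopes. *)

Section WordSums.
Variables (R : realType) (A : finType).
Implicit Types (F G : seq A -> R).

Definition wsum n F : R := \sum_(u : n.-tuple A) F (tval u).

Lemma eq_wsum n F G : (forall u, size u = n -> F u = G u) -> wsum n F = wsum n G.
Proof. by move=> FG; apply: eq_bigr => u _; apply: FG; rewrite size_tuple. Qed.

Lemma ler_wsum n F G :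
  (forall u, size u = n -> F u <= G u) -> wsum n F <= wsum n G.
Proof. by move=> FG; apply: ler_sum => u _; apply: FG; rewrite size_tuple. Qed.

Lemma wsum_ge0 n F : (forall u, size u = n -> 0 <= F u) -> 0 <= wsum n F.
Proof. by move=> F0; apply: sumr_ge0 => u _; apply: F0; rewrite size_tuple. Qed.

Lemma wsumD n F G : wsum n (fun u => F u + G u) = wsum n F + wsum n G.
Proof. exact: big_split. Qed.

Lemma wsumN n F : wsum n (fun u => - F u) = - wsum n F.
Proof. exact: sumrN. Qed.

Lemma wsumZ n c F : wsum n (fun u => c * F u) = c * wsum n F.
Proof. by rewrite /wsum mulr_sumr. Qed.

Lemma wsum_sum (I : finType) n (F : I -> seq A -> R) :
  wsum n (fun u => \sum_i F i u) = \sum_i wsum n (F i).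
Proof. exact: exchange_big. Qed.

Lemma wsum0 F : wsum 0 F = F [::].
Proof.
rewrite /wsum (bigD1 [tuple])//= big1 ?addr0// => u.
by rewrite (tuple0 u) => /eqP[].
Qed.

Lemma wsumS n F : wsum n.+1 F = \sum_a wsum n (fun u => F (a :: u)).
Proof.
rewrite /wsum pair_big /=.
rewrite (reindex (fun p : A * n.-tuple A => [tuple of p.1 :: p.2])) //=.
exists (fun t => (thead t, [tuple of behead t])) => [[a u]|u] _ /=.
  by congr pair; apply: val_inj.
by rewrite [RHS]tuple_eta.
Qed.

Lemma wsumSr n F : wsum n.+1 F = \sum_a wsum n (fun u => F (rcons u a)).
Proof.
elim: n F => [|n IH] F.
  by rewrite wsumS; apply: eq_bigr => a _; rewrite !wsum0.
rewrite wsumS; under eq_bigr do rewrite IH.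
rewrite exchange_big /=; apply: eq_bigr => b _.
by rewrite wsumS.
Qed.

Lemma wsum_cat m n F :
  wsum (m + n) F = wsum m (fun u => wsum n (fun v => F (u ++ v))).
Proof.
elim: m F => [|m IH] F; first by rewrite add0n wsum0.
by rewrite addSn !wsumS; apply: eq_bigr => a _; rewrite IH.
Qed.

Lemma wsum_ge n F v : (forall u, 0 <= F u) -> size v = n -> F v <= wsum n F.
Proof.
move=> F0 /eqP vn; rewrite /wsum (bigD1 (Tuple vn))//= lerDl.
by apply: sumr_ge0 => *; exact: F0.
Qed.

Lemma wsum_pred1 n F v : size v = n -> wsum n (fun u => if u == v then F u else 0) = F v.
Proof.
move=> /eqP vn; rewrite /wsum (bigD1 (Tuple vn))//= eqxx big1 ?addr0// => u.
by rewrite -val_eqE /= => /negPf ->.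
Qed.

End WordSums.

Lemma exchange_wsum (R : realType) (A B : finType) m n (F : seq A -> seq B -> R) :
  wsum m (fun u => wsum n (F u)) = wsum n (fun v => wsum m (F^~ v)).
Proof. exact: exchange_big. Qed.

(** * The Gibbs inequality *)

Section Gibbs.
Variable R : realType.
Implicit Types x y : R.

Lemma ln2_gt0 : 0 < ln 2 :> R.
Proof. by rewrite ln_gt0// ltr1n. Qed.

Lemma log21 : log2 1 = 0 :> R. Proof. by rewrite /log2 ln1 mul0r. Qed.

Lemma log22 : log2 2 = 1 :> R. Proof. by rewrite /log2 divff// gt_eqF// ln2_gt0. Qed.

Lemma log2M x y : 0 < x -> 0 < y -> log2 (x * y) = log2 x + log2 y.
Proof. by move=> x0 y0; rewrite /log2 lnM ?posrE// mulrDl. Qed.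

Lemma log2V x : 0 < x -> log2 x^-1 = - log2 x.
Proof. by move=> x0; rewrite /log2 lnV ?posrE// mulNr. Qed.

Lemma log2_div x y : 0 < x -> 0 < y -> log2 (x / y) = log2 x - log2 y.
Proof. by move=> x0 y0; rewrite log2M ?invr_gt0// log2V. Qed.

Lemma log2_powR x : log2 (2 `^ x) = x.
Proof. by rewrite /log2 ln_powR mulfK// gt_eqF// ln2_gt0. Qed.

Lemma ler_log2 x y : 0 < x -> x <= y -> log2 x <= log2 y.
Proof.
move=> x0 xy; rewrite /log2 ler_pM2r ?invr_gt0 ?ln2_gt0// ler_ln ?posrE//.
exact: lt_le_trans xy.
Qed.

Lemma log2_le0 x : x <= 1 -> log2 x <= 0.
Proof.
by move=> x1; rewrite /log2 mulr_le0_ge0 ?ln_le0// invr_ge0 ltW// ln2_gt0.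
Qed.

Lemma xlog2xE x : xlog2x x = x * log2 x.
Proof. by rewrite /xlog2x; case: eqP => // ->; rewrite mul0r. Qed.

Lemma ln_lt_sub1 x : 0 < x -> x != 1 -> ln x < x - 1.
Proof.
move=> x0 x1; have : ln x != 0 by rewrite ln_eq0.
by move=> /expR_gt1Dx; rewrite lnK ?posrE//; lra.
Qed.

Lemma ln_le_sub1 x : 0 < x -> ln x <= x - 1.
Proof.
move=> x0; have [->|x1] := eqVneq x 1; first by rewrite ln1 subrr.
exact/ltW/ln_lt_sub1.
Qed.

(** This is [ln t <= t - 1] at [t = y / x], multiplied by [x]. Since [ln 0 = 0] here, the case
    [y = 0 < x] must be excluded by hypothesis. *)
Lemma mul_ln_sub_le x y : 0 <= x -> 0 <= y -> (y = 0 -> x = 0) ->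
  x * ln y - x * ln x <= y - x ?= iff (x == y).
Proof.
move=> x0 y0 yx; have [x_eq0|x_neq0] := eqVneq x 0.
  by rewrite x_eq0 !mul0r !subr0; apply/leifP; case: (eqVneq 0 y) => [e|ne]; rewrite ?e// lt0r eq_sym ne.
have xp : 0 < x by rewrite lt0r x_neq0.
have yp : 0 < y by rewrite lt0r y0 andbT; apply/eqP => /yx /eqP; apply/negP.
have -> : y - x = x * (y / x - 1) by field.
rewrite -mulrBr -ln_div ?posrE//; apply/leifP; case: (eqVneq x y) => [<-|xy].
  by rewrite divff// ln1 subrr.
rewrite ltr_pM2l// ln_lt_sub1 ?divr_gt0//.
by apply: contra xy => /eqP yx1; rewrite -[y](divfK x_neq0) yx1 mul1r.
Qed.

Variable T : finType.
Implicit Types P Q : T -> R.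

(** The total mass of [Q] is only bounded by 1, as the comparison weights of [condH_subadditive] may
    lose mass. Equality of the two entropies squeezes [\sum_t (Q t - P t)] to 0, and the equality
    case of each summand applies. *)
Lemma gibbs_leif P Q : (forall t, 0 <= P t) -> (forall t, 0 <= Q t) ->
    \sum_t P t = 1 -> \sum_t Q t <= 1 -> (forall t, Q t = 0 -> P t = 0) ->
  (- \sum_t xlog2x (P t) <= - \sum_t P t * log2 (Q t)) /\
  (- \sum_t xlog2x (P t) = - \sum_t P t * log2 (Q t) -> forall t, P t = Q t).
Proof.
move=> P0 Q0 P1 Q1 QP.
pose d t := P t * ln (Q t) - P t * ln (P t).
have dE : \sum_t P t * log2 (Q t) - \sum_t xlog2x (P t) = (\sum_t d t) / ln 2.
  rewrite -sumrB mulr_suml; apply: eq_bigr => t _.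
  by rewrite xlog2xE /log2 /d; ring.
have dle : \sum_t d t <= \sum_t (Q t - P t) ?= iff [forall t, P t == Q t].
  by apply: leif_sum => t _; apply: mul_ln_sub_le => // /QP.
have s0 : \sum_t (Q t - P t) <= 0 by rewrite sumrB P1 subr_le0.
split.
  rewrite lerNl opprK -subr_le0 dE mulr_le0_ge0// ?invr_ge0 ?(ltW ln2_gt0)//.
  exact: le_trans dle.1 s0.
move=> /oppr_inj PQ; have /eqP := dE; rewrite PQ subrr eq_sym mulf_eq0 invr_eq0.
rewrite (gt_eqF ln2_gt0) orbF => /eqP d0 t.
move: dle; rewrite d0 => -[s0']; have -> : \sum_t (Q t - P t) = 0 by apply/eqP; rewrite eq_le s0.
by rewrite eqxx => /esym/forallP/(_ t)/eqP.
Qed.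

End Gibbs.

Lemma wgibbs (R : realType) (A : finType) n (P Q : seq A -> R) :
  (forall u, 0 <= P u) -> (forall u, 0 <= Q u) ->
  wsum n P = 1 -> wsum n Q <= 1 -> (forall u, size u = n -> Q u = 0 -> P u = 0) ->
  (- wsum n (fun u => xlog2x (P u)) <= - wsum n (fun u => P u * log2 (Q u))) /\
  (- wsum n (fun u => xlog2x (P u)) = - wsum n (fun u => P u * log2 (Q u)) ->
    forall u, size u = n -> P u = Q u).
Proof.
move=> P0 Q0 P1 Q1 QP.
have QPt (t : n.-tuple A) : Q t = 0 -> P t = 0 by apply: QP; rewrite size_tuple.
have [le_ eq_] := gibbs_leif (fun t : n.-tuple A => P0 t) (fun t => Q0 t) P1 Q1 QPt.
split=> // e u /eqP un; exact: (eq_ e (Tuple un)).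
Qed.

(** * Consistent families of word probabilities and their block entropies *)

Section WordLaw.
Variable R : realType.

(** These are the cylinder probabilities of a shift-invariant measure: words carry no position, so
    invariance amounts to consistency on both sides. *)
Definition word_law (A : finType) (q : seq A -> R) : Prop :=
  [/\ forall u, 0 <= q u, q [::] = 1,
      forall u, \sum_a q (a :: u) = q u & forall u, \sum_a q (rcons u a) = q u].

Definition lawH (A : finType) (q : seq A -> R) n : R :=
  - wsum n (fun u => xlog2x (q u)).

(** Push-forward under the one-block code [F]. *)
Definition image_law (A B : finType) (F : A -> B) (q : seq A -> R) (r : seq B -> R) : Prop :=
  forall v, r v = wsum (size v) (fun u => if map F u == v then q u else 0).

Section OneLaw.
Variables (A : finType) (q : seq A -> R).
Hypothesis ql : word_law q.

Lemma law_ge0 u : 0 <= q u. Proof. by case: ql. Qed.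

Lemma law_catr n u : wsum n (fun v => q (u ++ v)) = q u.
Proof.
case: ql => _ _ _ qr; elim: n u => [|n IH] u; first by rewrite wsum0 cats0.
rewrite wsumS -qr; apply: eq_bigr => a _; rewrite -(IH (rcons u a)).
by apply: eq_wsum => v _; rewrite cat_rcons.
Qed.

Lemma law_catl n v : wsum n (fun u => q (u ++ v)) = q v.
Proof.
case: ql => _ _ qr _; elim: n v => [|n IH] v; first by rewrite wsum0.
rewrite wsumSr -qr; apply: eq_bigr => a _; rewrite -(IH (a :: v)).
by apply: eq_wsum => u _; rewrite cat_rcons.
Qed.

Lemma law_sum n : wsum n q = 1.
Proof. by have := law_catr n [::]; case: ql => _ ->. Qed.

Lemma law_lel u v : q (u ++ v) <= q u.
Proof.
rewrite -(law_catr (size v) u).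
by apply: (@wsum_ge _ _ _ (fun w => q (u ++ w))) => // w; exact: law_ge0.
Qed.

Lemma law_ler u v : q (u ++ v) <= q v.
Proof.
rewrite -(law_catl (size u) v).
by apply: (@wsum_ge _ _ _ (fun w => q (w ++ v))) => // w; exact: law_ge0.
Qed.

Lemma law_le1 u : q u <= 1.
Proof. by have := law_lel [::] u; case: ql => _ ->. Qed.

Lemma lawH_ge0 n : 0 <= lawH q n.
Proof.
rewrite oppr_ge0 -oppr_ge0 -wsumN; apply: wsum_ge0 => u _.
by rewrite xlog2xE oppr_ge0 mulr_ge0_le0 ?law_ge0// log2_le0// law_le1.
Qed.

(** By invariance each of the [n] positions follows the one-letter law. *)
Lemma law_sum_additive n (g : A -> R) :
  wsum n (fun u => q u * \sum_(a <- u) g a) = n%:R * \sum_a q [:: a] * g a.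
Proof.
elim: n => [|n IH]; first by rewrite wsum0 big_nil mulr0 mul0r.
rewrite wsumS -[n.+1]add1n natrD mulrDl mul1r -IH.
under eq_bigr => a _ do under eq_wsum => u _ do rewrite big_cons mulrDr mulrC.
under eq_bigr => a _ do rewrite wsumD wsumZ (law_catr n [:: a]) mulrC.
rewrite big_split /=; congr +%R.
rewrite -wsum_sum; apply: eq_wsum => u _; rewrite -mulr_suml.
by case: ql => _ _ -> _.
Qed.

End OneLaw.

Section Image.
Variables (A B : finType) (F : A -> B) (q : seq A -> R) (r : seq B -> R).
Hypotheses (ql : word_law q) (rE : image_law F q r).

Lemma image_law_sum n (g : seq B -> R) :
  wsum n (fun u => q u * g (map F u)) = wsum n (fun v => r v * g v).
Proof.
transitivity (wsum n (fun v : seq B => wsum n (fun u => if map F u == v then q u * g v else 0))).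
  rewrite exchange_wsum; apply: eq_wsum => u un.
  transitivity (wsum n (fun v : seq B => if v == map F u then q u * g v else 0)).
    by rewrite wsum_pred1// size_map.
  by apply: eq_wsum => v _; rewrite eq_sym.
apply: eq_wsum => v vn; rewrite rE vn mulrC -wsumZ; apply: eq_wsum => u _.
by case: ifP => _; rewrite ?mulr0// mulrC.
Qed.

Lemma image_law_ge u : q u <= r (map F u).
Proof.
rewrite rE size_map.
have := @wsum_ge R A (size u) (fun w => if map F w == map F u then q w else 0) u.
rewrite eqxx; apply => // w; case: ifP => // _; exact: law_ge0.
Qed.

(** Since [q u <= r (map F u)], replacing [log2 (q u)] by [log2 (r (map F u))] can only increase the
    sum, and the latter depends on the image word alone. *)
Lemma lawH_image n : lawH r n <= lawH q n.
Proof.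
rewrite lerN2; apply: le_trans (_ : wsum n (fun u => q u * log2 (r (map F u))) <= _).
  apply: ler_wsum => u _; rewrite xlog2xE.
  have := law_ge0 ql u; rewrite le_eqVlt => /orP[/eqP<-|qp]; first by rewrite !mul0r.
  by rewrite ler_pM2l// ler_log2// image_law_ge.
rewrite (image_law_sum n (fun v => log2 (r v))).
by apply: ler_wsum => v _; rewrite xlog2xE.
Qed.

End Image.

End WordLaw.

(** * Shift spaces: windows, cylinders and their measures *)

Section Windows.
Variable A : Type.
Implicit Types (x : int -> A) (m : int) (n : nat).

Lemma size_win x m n : size (win x m n) = n.
Proof. by rewrite size_map size_iota. Qed.

Lemma winS x m n : win x m n.+1 = x m :: win x (m + 1) n.
Proof.
rewrite /win /= addr0; congr cons; rewrite -[1%N]addn0 iotaDl -map_comp.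
by apply: eq_map => i /=; rewrite PoszD addrA.
Qed.

Lemma winSr x m n : win x m n.+1 = rcons (win x m n) (x (m + n%:Z)).
Proof. by rewrite /win -addn1 iotaD map_cat cats1. Qed.

Lemma win_cat x m n k : win x m (n + k) = win x m n ++ win x (m + n%:Z) k.
Proof.
elim: n m => [|n IH] m; first by rewrite add0n addr0.
by rewrite addSn !winS IH /= -addrA -PoszD add1n.
Qed.

Lemma win_shift x m n : win (shift x) m n = win x (m + 1) n.
Proof. by apply: eq_map => i; rewrite /shift addrAC. Qed.

Lemma win_map (B : Type) (F : A -> B) x m n :
  win (fun i => F (x i)) m n = map F (win x m n).
Proof. by rewrite /win -map_comp. Qed.

Lemma win_sub x m n (k : int) N : m <= k -> k + n%:Z <= m + N%:Z ->
  win x k n = take n (drop `|k - m| (win x m N)).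
Proof.
move=> mk kN.
have -> : N = (`|k - m| + (n + (N - n - `|k - m|)))%N by lia.
rewrite win_cat drop_size_cat ?size_win// win_cat.
have -> : m + `|k - m|%N = k by lia.
by rewrite take_size_cat// size_win.
Qed.

Lemma cyl_rcons m (u : seq A) (a : A) :
  cyl m (rcons u a) = cyl m u `&` [set x | x (m + (size u)%:Z) = a].
Proof.
apply/seteqP; split => x /=; rewrite /cyl /= size_rcons winSr.
  by move=> /rcons_inj[].
by move=> [-> ->].
Qed.

Lemma cyl_cons m (u : seq A) (a : A) : cyl m (a :: u) = cyl (m + 1) u `&` [set x | x m = a].
Proof.
apply/seteqP; split => x /=; rewrite /cyl /= winS.
  by move=> -[-> ->].
by move=> [-> ->].
Qed.

End Windows.

Lemma prob_image (R : realType) d d' (S : measurableType d) (T : measurableType d')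
    (mu : probability S R) (f : S -> T) : measurable_fun setT f ->
  exists nu : probability T R, forall B, nu B = mu (f @^-1` B).
Proof. by move=> mf; exists (distribution mu (mfun_Sub (mem_set mf))). Qed.

Section ShiftMeasure.
Variables (R : realType) (A : PFin.type).
Local Notation Om := (ShiftSpace A).

Lemma measurable_cyl m (u : seq A) : measurable (cyl m u : set Om).
Proof. by apply: sub_sigma_algebra; exists m, u. Qed.

Lemma measurable_win m n (P : set (seq A)) : measurable ([set x | P (win x m n)] : set Om).
Proof.
have -> : [set x : Om | P (win x m n)] =
   \bigcup_(u : seq A) (if `[<P u>] && (size u == n) then cyl m u else set0).
  apply/seteqP; split => x /=.
    move=> Px; exists (win x m n) => //; rewrite size_win eqxx andbT asboolT//.
    by rewrite /cyl /= size_win.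
  by move=> [u _]; case: ifP => // /andP[/asboolP Pu /eqP <-]; rewrite /cyl /= => ->.
apply: countable_bigcupT_measurable => [|u]; first exact: countableP.
by case: ifP => _; [exact: measurable_cyl|exact: measurable0].
Qed.

Section Fibers.
Context d (T : measurableType d) (mu : {measure set T -> \bar R}).

Lemma measure_fibers (I : finType) (D : set T) (g : T -> I) :
  (forall i, measurable (D `&` [set x | g x = i])) ->
  mu D = (\sum_i mu (D `&` [set x | g x = i]))%E.
Proof.
move=> mD; have {1}-> : D = \bigcup_(i in [set: I]) (D `&` [set x | g x = i]).
  by apply/seteqP; split => [x Dx|x [i _ []]//]; exists (g x).
rewrite measure_fin_bigcup//; last first.
  by apply/trivIsetP => i j _ _ /eqP ij; apply/seteqP; split => // x /= [[_ ->] [_ /ij]].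
  exact: finite_finset.
rewrite (_ : [set: I] = [set` index_enum I]) -?fsbig_seq ?index_enum_uniq//.
by apply/seteqP; split => i //= _; rewrite mem_index_enum.
Qed.

End Fibers.

Section Prob.
Variable mu : probability Om R.

Definition law (u : seq A) : R := fine (mu (cyl 0 u)).

Lemma fin_num_cyl m u : mu (cyl m u) \is a fin_num.
Proof. by apply: fin_num_measure; exact: measurable_cyl. Qed.

Lemma fine_cyl_rcons m u : \sum_a fine (mu (cyl m (rcons u a))) = fine (mu (cyl m u)).
Proof.
rewrite (@measure_fibers _ _ mu A (cyl m u) (fun x => x (m + (size u)%:Z)));
  last by move=> a; rewrite -cyl_rcons; exact: measurable_cyl.
by under [in RHS]eq_bigr do rewrite -cyl_rcons; rewrite -sum_fine// => a _; exact: fin_num_cyl.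
Qed.

Lemma fine_cyl_cons m u : \sum_a fine (mu (cyl m (a :: u))) = fine (mu (cyl (m + 1) u)).
Proof.
rewrite (@measure_fibers _ _ mu A (cyl (m + 1) u) (fun x => x m));
  last by move=> a; rewrite -cyl_cons; exact: measurable_cyl.
by under [in RHS]eq_bigr do rewrite -cyl_cons; rewrite -sum_fine// => a _; exact: fin_num_cyl.
Qed.

Lemma cyl_wsumr m u n :
  fine (mu (cyl m u)) = wsum n (fun v => fine (mu (cyl m (u ++ v)))).
Proof.
elim: n u => [|n IH] u; first by rewrite wsum0 cats0.
rewrite wsumS -fine_cyl_rcons; apply: eq_bigr => a _; rewrite (IH (rcons u a)).
by apply: eq_wsum => v _; rewrite cat_rcons.
Qed.

Lemma cyl_wsuml m u n :
  fine (mu (cyl m u)) = wsum n (fun v => fine (mu (cyl (m - n%:Z) (v ++ u)))).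
Proof.
elim: n m u => [|n IH] m u; first by rewrite wsum0 subr0.
rewrite wsumSr -[in LHS](subrK 1 m) -fine_cyl_cons; apply: eq_bigr => a _.
rewrite IH; apply: eq_wsum => v _; rewrite cat_rcons.
by congr (fine (mu (cyl _ _))); lia.
Qed.

Lemma cyl0 m : cyl m [::] = [set: Om].
Proof. by apply/seteqP; split. Qed.

Lemma law_word_law : invariant mu -> word_law law.
Proof.
move=> inv; split.
- by move=> u; rewrite fine_ge0.
- by rewrite /law cyl0 probability_setT.
- move=> u; rewrite /law (fine_cyl_cons 0 u) add0r; congr fine.
  rewrite -[in RHS]inv; last exact: measurable_cyl.
  by congr (mu _); apply/seteqP; split => x /=; rewrite /cyl /= win_shift.
- by move=> u; rewrite /law fine_cyl_rcons.
Qed.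

Lemma invariant_cyl : invariant mu -> forall m u, mu (cyl m u) = (law u)%:E.
Proof.
move=> inv.
have sh (m : int) (u : seq A) : mu (cyl (m + 1) u) = mu (cyl m u).
  rewrite -[in RHS]inv; last exact: measurable_cyl.
  by congr (mu _); apply/seteqP; split => x /=; rewrite /cyl /= win_shift.
have shn (m : int) (n : nat) (u : seq A) : mu (cyl (m + n%:Z) u) = mu (cyl m u).
  elim: n => [|n IH]; first by rewrite addr0.
  have -> : m + n.+1%:Z = m + n%:Z + 1 by lia.
  by rewrite sh.
move=> m u; rewrite /law fineK ?fin_num_cyl//.
have [m0|m0] := leP 0 m; first by rewrite -(shn 0 `|m|%N); congr (mu (cyl _ _)); lia.
by rewrite -(shn m `|m|%N); congr (mu (cyl _ _)); lia.
Qed.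

End Prob.

(* The events depending on a symmetric window form a pi-system containing the
   cylinders. *)
Lemma measure_unique_cyl (m1 m2 : {measure set Om -> \bar R}) :
  (m1 setT < +oo)%E -> (forall m u, m1 (cyl m u) = m2 (cyl m u)) ->
  forall B : set Om, measurable B -> m1 B = m2 B.
Proof.
move=> fin1 agree.
pose ev (k : nat) (P : set (seq A)) : set Om := [set x | P (win x (- k%:Z) k.*2)].
pose G : set (set Om) := [set E | exists k P, E = ev k P].
have evT : ev 0%N setT = setT by apply/seteqP; split.
have GT : G setT by exists 0%N, setT.
have Gm : G `<=` measurable by move=> _ [k [P ->]]; exact: measurable_win.
have up (k l : nat) x : (k <= l)%N ->
    win x (- k%:Z) k.*2 = take k.*2 (drop (l - k) (win x (- l%:Z) l.*2)) :> seq A.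
  by move=> kl; rewrite (@win_sub _ x (- l%:Z) _ _ l.*2)//; try lia; congr (take _ (drop _ _)); lia.
have GI : setI_closed G.
  move=> _ _ [k [P ->]] [l [Q ->]]; exists (maxn k l).
  exists [set w | P (take k.*2 (drop (maxn k l - k) w)) /\
                  Q (take l.*2 (drop (maxn k l - l) w))].
  apply/seteqP; split => x; rewrite /ev /=.
    by move=> [Px Qx]; split; rewrite -up// ?leq_maxl ?leq_maxr.
  by rewrite -!up ?leq_maxl ?leq_maxr.
have cylG : @cylinders A `<=` <<s G >>.
  move=> _ [m [u ->]]; apply: sub_sigma_algebra.
  set k := (`|m| + size u)%N; exists k.
  exists [set w | take (size u) (drop `|m - - k%:Z| w) = u].
  by apply/seteqP; split => x; rewrite /ev /cyl /= -win_sub//; rewrite /k; lia.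
move=> B mB.
apply: (@g_sigma_algebra_measure_unique _ _ _ G Gm (fun=> setT)) => //.
- by rewrite bigcup_const//; exists 0%N.
- move=> _ [k [P ->]].
  pose g (x : Om) : k.*2.-tuple A := Tuple (introT eqP (size_win x (- k%:Z) k.*2)).
  (* A window event is the finite disjoint union of the cylinders of its words, on which the
     measures agree. *)
  have fib (t : k.*2.-tuple A) : ev k P `&` [set x | g x = t] =
      (if `[<P t>] then cyl (- k%:Z) t else set0).
    apply/seteqP; split => x /=.
      by move=> [Px <-]; rewrite asboolT// /cyl /= size_win.
    case: ifP => // /asboolP Pt; rewrite /cyl /= size_tuple => xt; split.
      by rewrite /ev /= xt.
    exact: val_inj.
  have mfib t : measurable (ev k P `&` [set x | g x = t]).
    by rewrite fib; case: ifP => _; [exact: measurable_cyl|exact: measurable0].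
  rewrite (measure_fibers m1 mfib) (measure_fibers m2 mfib).
  by apply: eq_bigr => t _; rewrite fib; case: ifP => _; rewrite ?measure0.
- exact: (smallest_sub (smallest_sigma_algebra _ _) cylG) mB.
Qed.

Lemma measurable_letter_map (B : PFin.type) (F : A -> B) :
  measurable_fun setT ((fun x i => F (x i)) : Om -> ShiftSpace B).
Proof.
apply: (@measurability _ _ Om (ShiftSpace B) setT _ (@cylinders B)) => // _ [_ [m [u ->]] <-].
rewrite setTI.
rewrite (_ : _ @^-1` _ = [set x | [set w | map F w = u] (win x m (size u))]).
  exact: measurable_win.
by apply/seteqP; split => x; rewrite /cyl /= (win_map F x).
Qed.

Lemma measurable_shift : measurable_fun setT (@shift A : Om -> Om).
Proof.
apply: (@measurability _ _ Om Om setT _ (@cylinders A)) => // _ [_ [m [u ->]] <-].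
rewrite setTI.
rewrite (_ : _ @^-1` _ = cyl (m + 1) u); first exact: measurable_cyl.
by apply/seteqP; split => x; rewrite /cyl /= win_shift.
Qed.

Lemma cyl_invariant (mu : probability Om R) :
  (forall (m : int) (u : seq A), mu (cyl (m + 1) u) = mu (cyl m u)) -> invariant mu.
Proof.
move=> mush.
have [sm smE] := prob_image mu measurable_shift.
move=> B mB; rewrite -smE; apply: measure_unique_cyl mB => [|m u].
  by rewrite -ge0_fin_numE// fin_num_measure.
apply: (etrans (smE _)); apply: (etrans _ (mush m u)); congr (mu _); apply/seteqP.
by split => x; rewrite /cyl /= win_shift.
Qed.

End ShiftMeasure.

Section LetterMap.
Variables (R : realType) (A B : PFin.type) (F : A -> B).
Variables (mu : probability (ShiftSpace A) R) (nu : probability (ShiftSpace B) R).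
Hypothesis nuE : forall m (v : seq B), nu (cyl m v) = mu [set x | win (fun i => F (x i)) m (size v) = v].

Lemma image_cyl m (v : seq B) : fine (nu (cyl m v)) =
  wsum (size v) (fun u => if map F u == v then fine (mu (cyl m u)) else 0).
Proof.
rewrite nuE.
pose n := size v.
pose g (x : ShiftSpace A) : n.-tuple A := Tuple (introT eqP (size_win x m n)).
set D := [set x | _].
have fib (t : n.-tuple A) : D `&` [set x | g x = t] = (if map F t == v then cyl m t else set0).
  apply/seteqP; split => x /=.
    move=> [Dx <-] /=; rewrite /D /= win_map in Dx.
    by rewrite Dx eqxx /cyl /= size_win.
  case: ifP => // /eqP Ft; rewrite /cyl /= size_tuple => xt; split.
    by rewrite /D /= win_map xt.
  exact: val_inj.
rewrite (@measure_fibers _ _ _ mu _ D g); last first.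
  by move=> t; rewrite fib; case: ifP => _; [exact: measurable_cyl|exact: measurable0].
rewrite -sum_fine.
  by apply: eq_bigr => t _; rewrite fib; case: ifP => _; rewrite ?measure0.
move=> t _; rewrite fib; case: ifP => _; rewrite ?measure0//; exact: fin_num_cyl.
Qed.

End LetterMap.

(** * Extension of a consistent family of word probabilities to a measure *)

Section UnitInterval.
Variable R : realType.

(** The sample space: a random sequence will be read off a uniform point of the unit interval. *)
Definition unit_leb : set (measurableTypeR R) -> \bar R :=
  mrestr (@lebesgue_measure R) (measurable_itv `[0%R, 1%R[).

HB.instance Definition _ := Measure.on unit_leb.

Lemma unit_leb_setT : unit_leb setT = 1%E.
Proof.
rewrite /unit_leb /mrestr setTI lebesgue_measure_itv/= lte_fin ltr01.
by rewrite oppr0 adde0.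
Qed.

HB.instance Definition _ := Measure_isProbability.Build _ _ R unit_leb unit_leb_setT.

End UnitInterval.

Section Extension.
Variables (R : realType) (A : PFin.type) (q : seq A -> R).
Hypothesis ql : word_law q.

(* A history lists letters in reverse order of appearance; the letter of rank
   [k] is put on the right of the window for even [k], on the left for odd [k]. *)
Fixpoint arrange (h : seq A) : seq A :=
  if h is a :: h' then
    if odd (size h') then a :: arrange h' else rcons (arrange h') a
  else [::].

Definition weight h := q (arrange h).

(** Where the piece of [a] begins, relative to the interval that [locate] cuts. *)
Fixpoint offset (w : A -> R) (s : seq A) (a : A) : R :=
  if s is b :: s' then if b == a then 0 else w b + offset w s' a else 0.

(* The half-open interval of length [\sum_(a <- s) w a] starting at [l] is cut
   into consecutive pieces of lengths [w a]; [locate] finds the piece of [t]. *)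
Fixpoint locate (w : A -> R) (s : seq A) (l t : R) : A :=
  if s is b :: s' then
    if t < l + w b then b else locate w s' (l + w b) t
  else point.

(** Histories correspond to nested intervals of length [weight h]; each is cut into those of its
    one-letter continuations. *)
Fixpoint left_end (h : seq A) : R :=
  if h is a :: h' then
    left_end h' + offset (fun b => weight (b :: h')) (enum A) a
  else 0.

Definition next (h : seq A) (t : R) : A :=
  locate (fun b => weight (b :: h)) (enum A) (left_end h) t.

Fixpoint hist (t : R) (k : nat) : seq A :=
  if k is k'.+1 then next (hist t k') t :: hist t k' else [::].

(** Coordinates are filled in the order 0, -1, 1, -2, 2, ..., matching the alternation of
    [arrange]. *)
Definition rank (i : int) : nat :=
  match i with Posz n => n.*2 | Negz n => n.*2.+1 end.

Definition point_of (t : R) : ShiftSpace A := fun i => next (hist t (rank i)) t.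

Lemma weight_ge0 h : 0 <= weight h. Proof. exact: (law_ge0 ql). Qed.

Lemma weight_sum h : \sum_a weight (a :: h) = weight h.
Proof.
rewrite /weight /=; case: ql => _ _ ll lr.
by case: (odd (size h)); [exact: ll|exact: lr].
Qed.

Lemma offset_ge0 w s a : (forall b, 0 <= w b) -> 0 <= offset w s a.
Proof.
by move=> w0; elim: s => //= b s IH; case: ifP => // _; rewrite addr_ge0.
Qed.

Lemma offset_le w s a : (forall b, 0 <= w b) -> a \in s ->
  offset w s a + w a <= \sum_(b <- s) w b.
Proof.
move=> w0; elim: s => //= b s IH; rewrite inE big_cons eq_sym.
case: eqP => [<- _|_ /IH]; first by rewrite add0r lerDl sumr_ge0.
by rewrite -addrA lerD2l.
Qed.

Lemma locateE w s a l t : (forall b, 0 <= w b) -> a \in s -> uniq s ->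
    l <= t < l + \sum_(b <- s) w b ->
  (locate w s l t = a) <-> (l + offset w s a <= t < l + offset w s a + w a).
Proof.
move=> w0; elim: s l => //= b s IH l; rewrite inE big_cons eq_sym => ains /andP[bs us] /andP[lt tl].
have [ba|ba] := eqVneq b a.
  rewrite -ba addr0 lt /=; case: ifP => [_//|/negbT]; rewrite -leNgt => lbt.
  split => // lb.
  (* Past the piece of [b] the search answers inside [s], which omits [b]; the upper bound on [t]
     excludes the default [point]. *)
  have : locate w s (l + w b) t \in s; last by rewrite lb (negPf bs).
  have {tl lt} : t < l + w b + \sum_(b <- s) w b by rewrite -addrA.
  elim: (s) (l + w b) lbt => [|c s' IHs] l' l't /=; first by rewrite big_nil addr0 ltNge l't.
  rewrite big_cons addrA => tl'; case: ifPn => [_|]; first by rewrite inE eqxx.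
  by rewrite -leNgt => c't; rewrite inE IHs ?orbT.
rewrite (negPf ba) /= in ains.
case: ifPn => [tlb|].
  split => [e|]; first by rewrite e eqxx in ba.
  rewrite addrA => /andP[+ _]; rewrite leNgt => /negP[].
  by apply: (lt_le_trans tlb); rewrite lerDl offset_ge0.
rewrite -leNgt => lbt; rewrite addrA; apply: IH => //.
by rewrite lbt -addrA.
Qed.

Lemma histP (t : R) h : 0 <= t < 1 ->
  (hist t (size h) = h) <-> (left_end h <= t < left_end h + weight h).
Proof.
move=> t01; elim: h => [|a h IH] /=.
  by rewrite /weight /= add0r; case: ql => _ -> _ _.
have lw : forall b, 0 <= weight (b :: h) by move=> b; exact: weight_ge0.
have ains : a \in enum A by rewrite mem_enum.
have sumE : \sum_(b <- enum A) weight (b :: h) = weight h.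
  by rewrite big_enum /= weight_sum.
split.
  move=> [nE hE]; rewrite hE in nE; have := (IH.1 hE) => lt.
  have := @locateE (fun b => weight (b :: h)) (enum A) a (left_end h) t lw ains (enum_uniq _).
  by rewrite sumE => /(_ lt)[+ _]; apply.
move=> lt.
have lt' : left_end h <= t < left_end h + weight h.
  case/andP: lt => l1 l2; apply/andP; split.
    by apply: le_trans l1; rewrite lerDl offset_ge0.
  apply: (lt_le_trans l2); rewrite -addrA lerD2l -sumE.
  exact: (@offset_le (fun b => weight (b :: h))).
have hE := IH.2 lt'; rewrite hE; congr cons.
have := @locateE (fun b => weight (b :: h)) (enum A) a (left_end h) t lw ains (enum_uniq _).
by rewrite sumE => /(_ lt')[_]; apply.
Qed.

Lemma left_end_bounds h : 0 <= left_end h /\ left_end h + weight h <= 1.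
Proof.
elim: h => [|a h [h0 h1]] /=; first by rewrite /weight add0r; case: ql => _ -> _ _.
have w0 : forall b, 0 <= weight (b :: h) by move=> b; exact: weight_ge0.
split; first by rewrite addr_ge0// offset_ge0.
apply: le_trans h1; rewrite -addrA lerD2l -(weight_sum h).
by have := @offset_le (fun b => weight (b :: h)) (enum A) a w0; rewrite big_enum mem_enum /=; apply.
Qed.

Lemma measurable_locate w s l a : measurable ([set t | locate w s l t = a] : set (measurableTypeR R)).
Proof.
elim: s l => [|b s IH] l /=.
  have [pa|pa] := pselect (point = a :> A).
    by rewrite (_ : [set _ | _] = setT)//; apply/seteqP; split.
  by rewrite (_ : [set _ | _] = set0)//; apply/seteqP; split.
rewrite (_ : [set _ | _] =
    (`]-oo, l + w b[%classic `&` [set _ | b = a]) `|`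
    (`[l + w b, +oo[%classic `&` [set t | locate w s (l + w b) t = a])); last first.
  apply/seteqP; split => t /=; rewrite !in_itv /= ?andbT.
    by case: ltP => tl e; [left|right].
  by case=> -[tl]; [rewrite tl|rewrite ltNge tl].
apply: measurableU; apply: measurableI => //; try exact: measurable_itv.
have [ba|ba] := pselect (b = a).
  by rewrite (_ : [set _ | _] = setT)//; apply/seteqP; split.
by rewrite (_ : [set _ | _] = set0)//; apply/seteqP; split.
Qed.

Lemma measurable_hist_eq k h : measurable ([set t | hist t k = h] : set (measurableTypeR R)).
Proof.
elim: k h => [|k IH] [|a h] /=.
- by rewrite (_ : [set _ | _] = setT)//; apply/seteqP; split.
- by rewrite (_ : [set _ | _] = set0)//; apply/seteqP; split.
- by rewrite (_ : [set _ | _] = set0)//; apply/seteqP; split.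
rewrite (_ : [set _ | _] = [set t | hist t k = h] `&` [set t | next h t = a]).
  by apply: measurableI => //; exact: measurable_locate.
by apply/seteqP; split => t /= [<- <-].
Qed.

Lemma measurable_hist k (P : set (seq A)) : measurable ([set t | P (hist t k)] : set (measurableTypeR R)).
Proof.
rewrite (_ : [set t | _] =
   \bigcup_(h : seq A) (if `[<P h>] then [set t | hist t k = h] else set0)).
  apply: countable_bigcupT_measurable => [|h]; first exact: countableP.
  by case: ifP => _; [exact: measurable_hist_eq|exact: measurable0].
apply/seteqP; split => t /=.
  by move=> Pt; exists (hist t k) => //; rewrite asboolT.
by move=> [h _]; case: ifP => // /asboolP Ph /= ->.
Qed.

(** Histories grow at the head, so letters are indexed from the end. *)
Lemma nth_hist t k j : (j < k)%N -> nth point (hist t k) (k - j.+1) = next (hist t j) t.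
Proof.
elim: k => // k IH; rewrite ltnS leq_eqVlt => /orP[/eqP->|jk].
  by rewrite subnn.
by rewrite subSS -(subnSK jk) /=; apply: IH.
Qed.

Lemma measurable_point_of : measurable_fun setT point_of.
Proof.
apply: (@measurability _ _ _ (ShiftSpace A) setT _ (@cylinders A)) => // _ [_ [m [u ->]] <-].
rewrite setTI.
(* Large enough to exceed the rank of every coordinate in the window, so that a history of length
   [k] determines the word read there. *)
pose k := (`|m| + size u).*2.+2.
pose dec (h : seq A) : seq A := [seq nth point h (k - (rank (m + i%:Z)).+1) | i <- iota 0 (size u)].
have decE t : dec (hist t k) = win (point_of t) m (size u).
  apply/eq_in_map => i; rewrite mem_iota leq0n add0n andTb => iu; rewrite nth_hist//.
  by case e : (m + i%:Z) => [n|n]; rewrite /k /=; lia.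
rewrite (_ : _ @^-1` _ = [set t | [set h | dec h = u] (hist t k)]).
  exact: (measurable_hist k [set h | dec h = u]).
by apply/seteqP; split => t; rewrite /cyl /= decE.
Qed.

Lemma size_arrange h : size (arrange h) = size h.
Proof.
by elim: h => //= a h IH; case: ifP => _ /=; rewrite ?size_rcons IH.
Qed.

(** Of the first [n] letters, those of odd rank went to the left; there are [n./2] of them, whence
    the start of the window. *)
Lemma hist_cyl (t : R) h :
  (hist t (size h) = h) <-> cyl (- (size h)./2%:Z) (arrange h) (point_of t).
Proof.
elim: h => [|a h IH]; first by rewrite /cyl /=; split.
have -> : hist t (size (a :: h)) = a :: h <-> (hist t (size h) = h /\ next (hist t (size h)) t = a).
  by rewrite /=; split => [[-> ->]|[-> ->]].
rewrite IH -[arrange (a :: h)]/(if odd (size h) then a :: arrange h else rcons (arrange h) a).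
rewrite -[size (a :: h)]/(size h).+1; case: ifP => od.
  rewrite cyl_cons.
  have -> : - (size h).+1./2%:Z = Negz (size h)./2 by lia.
  have -> : Negz (size h)./2 + 1 = - (size h)./2%:Z by lia.
  have rE : rank (Negz (size h)./2) = size h by rewrite /rank; lia.
  by rewrite -[in next _ t]rE.
rewrite cyl_rcons size_arrange.
have -> : (size h).+1./2 = (size h)./2 by lia.
have -> : - (size h)./2%:Z + (size h)%:Z = Posz (size h)./2 by lia.
have rE : rank (Posz (size h)./2) = size h by rewrite /rank; lia.
by rewrite -[in next _ t]rE.
Qed.

Lemma arrange_surj n u : size u = n -> exists2 h, size h = n & arrange h = u.
Proof.
elim: n u => [|n IH] u un; first by exists [::] => //; rewrite (size0nil un).
case od: (odd n).
  case: u un => //= a u [un]; have [h hn hu] := IH u un.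
  by exists (a :: h); rewrite /= ?hn ?od ?hu.
case/lastP: u un => // u a; rewrite size_rcons => -[un]; have [h hn hu] := IH u un.
by exists (a :: h); rewrite /= ?hn ?od ?hu.
Qed.

(** The measure is the image of Lebesgue measure under [point_of]: the parameters with a given
    history form an interval of the prescribed length. *)
Theorem word_law_extension :
  exists mu : probability (ShiftSpace A) R, forall m u, mu (cyl m u) = (q u)%:E.
Proof.
have [mu muE] := prob_image (@unit_leb R : probability _ R) measurable_point_of.
have arr h : mu (cyl (- (size h)./2%:Z) (arrange h)) = (weight h)%:E.
  rewrite muE.
  change (lebesgue_measure ((point_of @^-1` cyl (- (size h)./2%:Z) (arrange h)) `&`
    `[0%R, 1%R[%classic) = (weight h)%:E).
  rewrite (_ : _ `&` _ = `[left_end h, left_end h + weight h[%classic); last first.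
    apply/seteqP; split => t /=; rewrite !in_itv /=.
      by move=> [/hist_cyl hE t01]; apply/histP.
    have [l0 l1] := left_end_bounds h => /andP[lt tl].
    have t01 : 0 <= t < 1 by rewrite (le_trans l0 lt) (lt_le_trans tl l1).
    by split => //; apply/hist_cyl/histP => //; rewrite lt tl.
  rewrite lebesgue_measure_itv/= lte_fin ltrDl.
  have := weight_ge0 h; rewrite le_eqVlt => /orP[/eqP <-|->]; first by rewrite ltxx.
  by rewrite -EFinB addrAC subrr add0r.
have sym k (u : seq A) : size u = k -> fine (mu (cyl (- k./2%:Z) u)) = q u.
  by move=> /arrange_surj[h <- <-]; rewrite arr.
exists mu => m u; rewrite -(fineK (fin_num_cyl mu m u)); congr EFin.
have [N NE] : exists N, size u = N by exists (size u).
(* The window from [-k] to [k - 1] contains the cylinder's window; both sides are summed over the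
   letters that fill it up. *)
pose k := (`|m| + N)%N.
rewrite (cyl_wsuml mu m u `|m + k%:Z|).
rewrite -(law_catl ql `|m + k%:Z| u); apply: eq_wsum => v vn.
rewrite (cyl_wsumr _ _ _ (k.*2 - size (v ++ u))) -(law_catr ql (k.*2 - size (v ++ u)) (v ++ u)).
apply: eq_wsum => w wn; rewrite -(sym k.*2).
  by rewrite doubleK; congr (fine (mu (cyl _ _))); rewrite /k; lia.
by rewrite size_cat wn subnKC// size_cat vn !NE /k; lia.
Qed.

End Extension.

(** * Entropy of word laws *)

Lemma fekete (R : realType) (a : nat -> R) : (forall n, 0 <= a n) ->
    (forall m n, a (m + n)%N <= a m + a n) ->
  exists2 L, a n / n%:R @[n --> \oo] --> L & forall n, (0 < n)%N -> L <= a n / n%:R.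
Proof.
move=> a0 sub.
pose S : set R := [set a n / n%:R | n in [set n | (0 < n)%N]].
have infS : has_inf S.
  split; first by exists (a 1%N / 1%:R), 1%N.
  by exists 0 => _ [n n0 <-]; rewrite divr_ge0.
have infle n : (0 < n)%N -> inf S <= a n / n%:R.
  by move=> n0; apply: ge_inf; [exact: infS.2|exists n].
exists (inf S) => //; apply/cvgrPdist_lt => e e0.
have e2 : 0 < e / 2 by rewrite divr_gt0.
have [_ [m /= m0 <-] mlt] := inf_adherent e2 infS.
have lin r : a r <= a 0%N + r%:R * a 1%N.
  elim: r => [|r IH]; first by rewrite mul0r addr0.
  by have := sub r 1%N; rewrite addn1 -natr1 mulrDl mul1r; lra.
have mul k r : a (k * m + r)%N <= k%:R * a m + a r.
  elim: k => [|k IH]; first by rewrite mul0r add0r.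
  by have := sub m (k * m + r)%N; rewrite mulSn -addnA -natr1 mulrDl mul1r; lra.
(* Writing [n = k * m + r] with [r < m], the constant [C] bounds [a r] for every possible
   remainder. *)
pose C := a 0%N + m%:R * a 1%N.
have C0 : 0 <= C by rewrite addr_ge0// mulr_ge0.
near=> n.
have n0 : (0 < n)%N by near: n; exact: nbhs_infty_gt.
have nR : 0 < n%:R :> R by rewrite ltr0n.
have mR : 0 < m%:R :> R by rewrite ltr0n.
have Cn : C / n%:R < e / 2.
  rewrite ltr_pdivrMr// -ltr_pdivrMl//.
  by near: n; exact: nbhs_infty_gtr.
rewrite distrC ger0_norm ?subr_ge0 ?infle//.
have an : a n <= n%:R * (a m / m%:R) + C.
  rewrite {1}(divn_eq n m) (le_trans (mul _ _))// lerD//.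
    rewrite [n%:R * _]mulrCA [n%:R / _ in leRHS]mulrC mulrA.
    rewrite [(n %/ m)%:R * _]mulrC -mulrA ler_wpM2l// ler_pdivlMl// mulrC -natrM ler_nat.
    exact: leq_divM.
  apply: (le_trans (lin _)); rewrite lerD2l ler_wpM2r// ler_nat ltnW//.
  by rewrite ltn_mod.
have : a n / n%:R <= a m / m%:R + C / n%:R.
  by rewrite ler_pdivrMr// mulrDl divfK ?gt_eqF// mulrC.
lra.
Unshelve. all: end_near.
Qed.

Section Subadditive.
Variable R : realType.

Section Split.
Variables (A : finType) (q : seq A -> R).
Hypothesis ql : word_law q.

Lemma law_sum_take m n (g : seq A -> R) :
  wsum (m + n) (fun w => q w * g (take m w)) = wsum m (fun u => q u * g u).
Proof.
rewrite wsum_cat; apply: eq_wsum => u um; rewrite -(law_catr ql n u) mulrC -wsumZ.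
by apply: eq_wsum => v _; rewrite take_size_cat// mulrC.
Qed.

Lemma law_sum_drop m n (g : seq A -> R) :
  wsum (m + n) (fun w => q w * g (drop m w)) = wsum n (fun u => q u * g u).
Proof.
rewrite wsum_cat exchange_wsum; apply: eq_wsum => v vn.
rewrite -(law_catl ql m v) mulrC -wsumZ.
by apply: eq_wsum => u um; rewrite drop_size_cat// mulrC.
Qed.

End Split.

(** [lawH q - lawH r] is the entropy of a word given its image. Gibbs' inequality is applied against
    the weights [Q] that draw the image from [r], then each half of the word independently given its
    own half of the image. *)
Lemma condH_subadditive (A B : finType) (F : A -> B) (q : seq A -> R) (r : seq B -> R) m n :
    word_law q -> word_law r -> image_law F q r ->
  lawH q (m + n) - lawH r (m + n) <= (lawH q m - lawH r m) + (lawH q n - lawH r n).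
Proof.
move=> ql rl qr.
have q0 := law_ge0 ql; have r0 := law_ge0 rl.
pose c u := q u / r (map F u).
have c0 u : 0 <= c u by rewrite divr_ge0.
pose Q w := r (map F w) * (c (take m w) * c (drop m w)).
have cpos u : 0 < q u -> 0 < c u.
  by move=> qp; rewrite divr_gt0// (lt_le_trans qp)// (image_law_ge ql qr).
have qtd w : 0 < q w -> [/\ 0 < r (map F w), 0 < q (take m w) & 0 < q (drop m w)].
  move=> qp; split; first by rewrite (lt_le_trans qp)// (image_law_ge ql qr).
    by rewrite (lt_le_trans qp)// -{1}(cat_take_drop m w) (law_lel ql).
  by rewrite (lt_le_trans qp)// -{1}(cat_take_drop m w) (law_ler ql).
(* Only an inequality, as the quotient is 0 when [y = 0]; this is where [Q] may lose mass. *)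
have cancel_le x y : 0 <= x -> 0 <= y -> y * (x / y) <= x :> R.
  move=> x0 y0; have [->|y1] := eqVneq y 0; first by rewrite mul0r.
  by rewrite mulrC divfK.
have [||||w wn Qw0|le_ _] := @wgibbs R A (m + n) q Q.
- exact: q0.
- by move=> w; apply: mulr_ge0 => //; apply: mulr_ge0.
- exact: law_sum.
- rewrite wsum_cat -(law_sum ql m); apply: ler_wsum => u um.
  apply: le_trans (_ : c u * r (map F u) <= _); last first.
    by rewrite mulrC; apply: cancel_le.
  rewrite -(law_catr rl n (map F u)).
  have -> : wsum n (fun v => Q (u ++ v)) =
      c u * wsum n (fun v => q v * (r (map F u ++ map F v) / r (map F v))).
    rewrite -wsumZ; apply: eq_wsum => v vn.
    by rewrite /Q take_size_cat// drop_size_cat// map_cat /c; ring.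
  rewrite ler_wpM2l//.
  rewrite (image_law_sum qr n (fun v => r (map F u ++ v) / r v)).
  by apply: ler_wsum => v _; exact: cancel_le.
- have := q0 w; rewrite le_eqVlt => /orP[/eqP//|qp].
  have [rp qt qd] := qtd w qp.
  by move: Qw0 => /eqP; rewrite gt_eqF//; apply: mulr_gt0 => //; apply: mulr_gt0; exact: cpos.
pose lr u := log2 (r (map F u)); pose lq u := log2 (q u).
(* The logarithm of [Q] splits into the image and the two halves; by invariance each half
   contributes its own conditional entropy. *)
have logQ : wsum (m + n) (fun w => q w * log2 (Q w)) =
    - lawH r (m + n) + (- lawH q m + lawH r m) + (- lawH q n + lawH r n).
  transitivity (wsum (m + n) (fun w => q w * lr w +
     (q w * (lq (take m w) - lr (take m w)) + q w * (lq (drop m w) - lr (drop m w))))).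
    apply: eq_wsum => w _; rewrite -!mulrDr.
    have := q0 w; rewrite le_eqVlt => /orP[/eqP <-|qp]; first by rewrite !mul0r.
    have [rp qt qd] := qtd w qp.
    have rt : 0 < r (map F (take m w)) by rewrite (lt_le_trans qt)// (image_law_ge ql qr).
    have rd : 0 < r (map F (drop m w)) by rewrite (lt_le_trans qd)// (image_law_ge ql qr).
    rewrite /Q log2M//; last by apply: mulr_gt0; exact: cpos.
    by rewrite log2M ?cpos// !log2_div.
  have HE k : wsum k (fun u => q u * (lq u - lr u)) = - lawH q k + lawH r k.
    under eq_wsum => u _ do rewrite mulrBr.
    rewrite wsumD wsumN /lr (image_law_sum qr k (fun v => log2 (r v))) /lawH opprK.
    by congr (_ - _); apply: eq_wsum => u _; rewrite xlog2xE.
  rewrite !wsumD (law_sum_take ql m n (fun u => lq u - lr u)) (law_sum_drop ql m n (fun u => lq u - lr u)) !HE.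
  rewrite addrA; congr (_ + _ + _).
  rewrite /lr (image_law_sum qr _ (fun v => log2 (r v))) /lawH opprK.
  by apply: eq_wsum => u _; rewrite xlog2xE.
by move: le_; rewrite logQ -/(lawH q (m + n)); lra.
Qed.

(** The conditional case with a one-letter image alphabet, whose law has zero entropy. *)
Lemma lawH_subadditive (A : finType) (q : seq A -> R) m n : word_law q ->
  lawH q (m + n) <= lawH q m + lawH q n.
Proof.
move=> ql; pose r (v : seq unit) : R := 1.
have rl : word_law r.
  by split=> // u; rewrite /r sumr_const card_unit.
have H0 k : lawH r k = 0.
  rewrite /lawH /r -[RHS]oppr0; congr -%R.
  by rewrite -[RHS](mul0r (wsum k r)) -wsumZ; apply: eq_wsum => u _; rewrite xlog2xE log21 mulr0 mul0r.
have qr : image_law (fun=> tt) q r.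
  move=> v; rewrite /r -(law_sum ql (size v)); apply: eq_wsum => u uv.
  suff -> : [seq tt | _ <- u] = v by rewrite eqxx.
  by elim: u v uv => [|a u IH] [|[] v] //= [uv]; rewrite (IH v).
by have := condH_subadditive m n ql rl qr; rewrite !H0 !subr0.
Qed.

(** * Laws on pairs: joint entropy, and laws given by a base law and a kernel *)

Section Pairs.
Variables (B C : finType).

Lemma wsum_pair n (f : seq B -> seq C -> R) :
  wsum n (fun u : seq (B * C) => f (map fst u) (map snd u)) =
  wsum n (fun b => wsum n (f b)).
Proof.
elim: n f => [|n IH] f; first by rewrite !wsum0.
rewrite !wsumS; under [RHS]eq_bigr => b _ do under eq_wsum => v _ do rewrite wsumS.
under [RHS]eq_bigr => b _ do rewrite wsum_sum.
rewrite [RHS]pair_bigA /=; apply: eq_bigr => -[b c] _ /=.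
exact: (IH (fun u v => f (b :: u) (c :: v))).
Qed.

(** Gibbs' inequality against the product of the two marginals. *)
Lemma lawH_joint (q : seq (B * C) -> R) (q1 : seq B -> R) (q2 : seq C -> R) n :
    word_law q -> word_law q1 -> word_law q2 ->
    image_law fst q q1 -> image_law snd q q2 ->
  lawH q n <= lawH q1 n + lawH q2 n.
Proof.
move=> ql ql1 ql2 qq1 qq2.
have [||||w wn Qw0|le_ _] := @wgibbs R _ n q (fun u => q1 (map fst u) * q2 (map snd u)).
- exact: law_ge0.
- by move=> w; rewrite mulr_ge0 ?(law_ge0 ql1) ?(law_ge0 ql2).
- exact: law_sum.
- rewrite (wsum_pair n (fun b c => q1 b * q2 c)).
  under eq_wsum => b _ do rewrite wsumZ (law_sum ql2) mulr1.
  by rewrite (law_sum ql1).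
- have := law_ge0 ql w; rewrite le_eqVlt => /orP[/eqP//|qp].
  move: Qw0 => /eqP; rewrite gt_eqF// mulr_gt0// (lt_le_trans qp)//.
    exact: (image_law_ge ql qq1).
  exact: (image_law_ge ql qq2).
apply: (le_trans le_); rewrite -opprD lerN2 /lawH.
rewrite le_eqVlt; apply/orP; left; apply/eqP.
transitivity (wsum n (fun u => q u * log2 (q1 (map fst u)) + q u * log2 (q2 (map snd u)))).
  rewrite wsumD (image_law_sum qq1 n (fun v => log2 (q1 v))) (image_law_sum qq2 n (fun v => log2 (q2 v))).
  by congr +%R; apply: eq_wsum => u _; rewrite xlog2xE.
apply: eq_wsum => w _; rewrite -mulrDr.
have := law_ge0 ql w; rewrite le_eqVlt => /orP[/eqP <-|qp]; first by rewrite !mul0r.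
rewrite log2M// (lt_le_trans qp)//; first exact: (image_law_ge ql qq1).
exact: (image_law_ge ql qq2).
Qed.

Variables (r : seq B -> R) (g : B * C -> R).
Hypotheses (rl : word_law r) (g0 : forall a, 0 <= g a) (g1 : forall b, \sum_c g (b, c) = 1).

(** The base word follows [r]; given it, the second letters are independent with conditional
    probabilities [g (b, c)]. *)
Definition kernel_law (u : seq (B * C)) : R := r (map fst u) * \prod_(a <- u) g a.

Lemma sum_kernel (h : B -> R) : \sum_a h a.1 * g a = \sum_b h b.
Proof.
transitivity (\sum_b \sum_c h b * g (b, c)).
  by rewrite pair_bigA /=; apply: eq_bigr => -[].
by apply: eq_bigr => b _; rewrite -mulr_sumr g1 mulr1.
Qed.

Lemma kernel_law_word_law : word_law kernel_law.
Proof.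
split.
- by move=> u; rewrite mulr_ge0 ?(law_ge0 rl)// prodr_ge0.
- by rewrite /kernel_law big_nil mulr1; case: rl.
- move=> u; rewrite /kernel_law /=.
  under eq_bigr => a _ do rewrite big_cons mulrA.
  rewrite -mulr_suml (sum_kernel (fun b => r (b :: map fst u))).
  by case: rl => _ _ -> _.
- move=> u; rewrite /kernel_law.
  transitivity ((\sum_a r (rcons (map fst u) a.1) * g a) * \prod_(a <- u) g a).
    rewrite mulr_suml; apply: eq_bigr => a _.
    by rewrite map_rcons -(cats1 u) big_cat big_seq1 /= mulrA mulrAC.
  rewrite (sum_kernel (fun b => r (rcons (map fst u) b))).
  by case: rl => _ _ _ ->.
Qed.

Lemma wsum_kernel n (h : seq B -> R) :
  wsum n (fun u => h (map fst u) * \prod_(a <- u) g a) = wsum n h.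
Proof.
elim: n h => [|n IH] h; first by rewrite !wsum0 big_nil mulr1.
rewrite !wsumS -sum_kernel; apply: eq_bigr => a _.
rewrite -IH mulrC -wsumZ; apply: eq_wsum => u _.
by rewrite big_cons /= mulrCA mulrA.
Qed.

Lemma kernel_law_image : image_law fst kernel_law r.
Proof.
move=> v; rewrite -(wsum_pred1 r erefl) -wsum_kernel.
apply: eq_wsum => u _; rewrite /kernel_law; case: eqP => // _.
by rewrite mul0r.
Qed.

(** The logarithm of the product splits into a base term and a sum over letters. The domination
    hypothesis keeps every logarithm away from 0, where [log2] has a default value. *)
Lemma kernel_cross_entropy (q : seq (B * C) -> R) n :
    word_law q -> image_law fst q r -> (forall u a, a \in u -> 0 < q u -> 0 < g a) ->
  - wsum n (fun u => q u * log2 (kernel_law u)) =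
  lawH r n - n%:R * \sum_a q [:: a] * log2 (g a).
Proof.
move=> ql qr dom.
rewrite -(law_sum_additive ql) /lawH -opprD; congr -%R.
transitivity (wsum n (fun u => q u * log2 (r (map fst u)) + q u * \sum_(a <- u) log2 (g a))).
  apply: eq_wsum => u _; rewrite -mulrDr.
  have := law_ge0 ql u; rewrite le_eqVlt => /orP[/eqP <-|qp]; first by rewrite !mul0r.
  have gp a : a \in u -> 0 < g a by move=> au; exact: dom au qp.
  rewrite /kernel_law log2M; last 2 first.
  - by rewrite (lt_le_trans qp)// (image_law_ge ql qr).
  - by rewrite big_seq prodr_gt0// => a /gp.
  congr (_ * (_ + _)); elim: u gp {qp} => [|a u IH] gp; first by rewrite !big_nil log21.
  rewrite !big_cons log2M ?gp ?mem_head//; last first.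
    by rewrite big_seq prodr_gt0// => b bu; rewrite gp// inE bu orbT.
  by rewrite IH// => b bu; rewrite gp// inE bu orbT.
rewrite wsumD (image_law_sum qr n (fun v => log2 (r v))); congr +%R.
by apply: eq_wsum => u _; rewrite xlog2xE.
Qed.

Lemma lawH_kernel (q : seq (B * C) -> R) n :
    word_law q -> image_law fst q r -> (forall u a, a \in u -> 0 < q u -> 0 < g a) ->
  (lawH q n <= lawH r n - n%:R * \sum_a q [:: a] * log2 (g a)) /\
  (lawH q n = lawH r n - n%:R * (\sum_a q [:: a] * log2 (g a)) ->
    forall u, size u = n -> q u = kernel_law u).
Proof.
move=> ql qr dom; rewrite -(kernel_cross_entropy n ql qr dom); apply: wgibbs.
- exact: law_ge0.
- by move=> u; case: kernel_law_word_law.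
- exact: law_sum.
- by rewrite (law_sum kernel_law_word_law).
- move=> u _ k0; have := law_ge0 ql u; rewrite le_eqVlt => /orP[/eqP//|qp].
  move: k0 => /eqP; rewrite gt_eqF// mulr_gt0//.
    by rewrite (lt_le_trans qp)// (image_law_ge ql qr).
  by rewrite big_seq prodr_gt0// => a au; exact: dom au qp.
Qed.

Lemma lawH_kernel_law n :
  lawH kernel_law n = lawH r n - n%:R * \sum_a kernel_law [:: a] * log2 (g a).
Proof.
rewrite -(kernel_cross_entropy n kernel_law_word_law kernel_law_image) => [|u a au].
  by congr -%R; apply: eq_wsum => u _; rewrite xlog2xE.
(* The kernel law dominates itself: one letter with [g a = 0] makes the whole product vanish. *)
rewrite lt0r [0 < g a]lt0r g0 andbT => /andP[+ _]; apply: contra => /eqP ga.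
by rewrite /kernel_law (big_rem a)//= ga mul0r mulr0.
Qed.

End Pairs.

Section Images.
Variables (A B C : finType) (F : A -> B) (q : seq A -> R) (r : seq B -> R).
Hypotheses (ql : word_law q) (qr : image_law F q r).

Lemma image_word_law : word_law r.
Proof.
case: ql => q0 q1 qc qrc; split.
- by move=> v; rewrite qr wsum_ge0// => u _; case: ifP.
- by rewrite qr wsum0.
- move=> v; rewrite qr.
  under eq_bigr => b _ do rewrite qr /= wsumS.
  rewrite exchange_big /=.
  under eq_wsum => u _ do rewrite -qc.
  transitivity (wsum (size v) (fun u => \sum_a if map F u == v then q (a :: u) else 0)).
    rewrite wsum_sum; apply: eq_bigr => a _; rewrite -wsum_sum; apply: eq_wsum => u _.
    rewrite (bigD1 (F a))//= eqseq_cons eqxx big1 ?addr0// => b /negPf bFa.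
    by rewrite eqseq_cons eq_sym bFa.
  by apply: eq_wsum => u _; case: ifP => // _; rewrite big1.
- move=> v; rewrite qr.
  under eq_bigr => b _ do rewrite qr size_rcons wsumSr.
  rewrite exchange_big /=.
  under eq_wsum => u _ do rewrite -qrc.
  transitivity (wsum (size v) (fun u => \sum_a if map F u == v then q (rcons u a) else 0)).
    rewrite wsum_sum; apply: eq_bigr => a _; rewrite -wsum_sum; apply: eq_wsum => u _.
    rewrite (bigD1 (F a))//= map_rcons eqseq_rcons eqxx andbT big1 ?addr0// => b /negPf bFa.
    by rewrite eqseq_rcons [F a == b]eq_sym bFa andbF.
  by apply: eq_wsum => u _; case: ifP => // _; rewrite big1.
Qed.

Lemma image_law_comp (G : B -> C) (s : seq C -> R) :
  image_law (G \o F) q s -> image_law G r s.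
Proof.
move=> qs v; rewrite qs.
transitivity (wsum (size v) (fun u => q u * (map G (map F u) == v)%:R)).
  by apply: eq_wsum => u _; rewrite map_comp; case: eqP; rewrite ?mulr1 ?mulr0.
rewrite (image_law_sum qr (size v) (fun w => (map G w == v)%:R)).
by apply: eq_wsum => u _; case: eqP; rewrite ?mulr1 ?mulr0.
Qed.

Lemma image_law_neq0 v : 0 < r v -> exists2 u, map F u = v & 0 < q u.
Proof.
move=> rv; apply/not_exists2P => noq; move: rv; rewrite qr.
suff -> : wsum (size v) (fun u => if map F u == v then q u else 0) = 0 by rewrite ltxx.
rewrite -[RHS](mul0r (wsum (size v) q)) -wsumZ; apply: eq_wsum => u _; rewrite mul0r.
case: eqP => // uv; have [//|/negP] := noq u.
by rewrite -leNgt => q_le0; apply/eqP; rewrite eq_le q_le0 (law_ge0 ql).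
Qed.

End Images.

(** As [K] fixes the base letter, the factor [r] is constant on preimages, and the sum of products
    over preimage words is the product of letterwise sums. *)
Lemma kernel_law_map (B C D : finType) (K : B * C -> B * D) (r : seq B -> R)
    (g : B * C -> R) : (forall t, (K t).1 = t.1) ->
  image_law K (kernel_law r g)
    (kernel_law r (fun a => \sum_t if K t == a then g t else 0)).
Proof.
move=> K1 v; rewrite /kernel_law.
transitivity (wsum (size v) (fun u => r (map fst v) * if map K u == v then \prod_(a <- u) g a else 0)); last first.
  apply: eq_wsum => u _; case: eqP => [<-|_]; last by rewrite mulr0.
  by rewrite -map_comp; congr (r _ * _); apply: eq_map => t /=; rewrite K1.
rewrite wsumZ; congr *%R; elim: v => [|a v IH]; first by rewrite wsum0 !big_nil.
rewrite big_cons wsumS mulr_suml; apply: eq_bigr => t _.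
rewrite IH -wsumZ; apply: eq_wsum => u _ /=.
by rewrite eqseq_cons big_cons; case: eqP => _ /=; rewrite ?mul0r//; case: eqP; rewrite ?mulr0.
Qed.

Section Rigidity.
Variables (B C : finType) (q : seq (B * C) -> R) (r : seq B -> R) (s : seq C -> R).
Variable g : B * C -> R.
Hypotheses (ql : word_law q) (rl : word_law r) (sl : word_law s).
Hypotheses (qr : image_law fst q r) (qs : image_law snd q s).
Hypotheses (g0 : forall a, 0 <= g a) (g1 : forall b, \sum_c g (b, c) = 1).
Hypothesis r0 : lawH r n / n%:R @[n --> \oo] --> 0.

Let e := - \sum_a q [:: a] * log2 (g a).

Lemma lawH_rate_le h : (forall u a, a \in u -> 0 < q u -> 0 < g a) ->
  lawH s n / n%:R @[n --> \oo] --> h ->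
  h <= e /\ (h = e -> forall u, q u = kernel_law r g u).
Proof.
move=> dom sh.
pose c n := lawH q n - lawH r n.
have c0 n : 0 <= c n by rewrite subr_ge0 (lawH_image ql qr).
(* The Fekete limit is also a lower bound of all [c n / n], while Gibbs' inequality gives
   [c n <= n * e]; with [h = e] these meet for every [n]. *)
have [L cL Lle] := fekete c0 (fun m n => condH_subadditive m n ql rl qr).
(* Here [lawH s n <= lawH q n = c n + lawH r n], and the last term is negligible by zero entropy of
   the base. *)
have hL : h <= L.
  rewrite -[L]addr0; apply: (ler_cvg_to sh (cvgD cL r0)); apply: nearW => n /=.
  by rewrite -mulrDl subrK ler_wpM2r// (lawH_image ql qs).
have cle n : c n <= n%:R * e.
  have [+ _] := lawH_kernel rl g0 g1 n ql qr dom.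
  by rewrite /c /e; lra.
split.
  apply: (le_trans hL); apply: (le_trans (Lle 1%N isT)).
  by have := cle 1%N; rewrite divr1 mul1r.
move=> he u; have [u0|u0] := posnP (size u).
  by rewrite (size0nil u0) /kernel_law big_nil mulr1; case: ql => _ -> _ _; case: rl.
have [_ +] := lawH_kernel rl g0 g1 (size u) ql qr dom; apply => //.
apply/eqP; rewrite eq_le; have [-> /= _] := lawH_kernel rl g0 g1 (size u) ql qr dom.
have := Lle _ u0; rewrite ler_pdivlMr ?ltr0n// /c => h1.
have : e * (size u)%:R <= L * (size u)%:R by rewrite ler_wpM2r// -he.
by rewrite /e; lra.
Qed.

End Rigidity.

(** [lawH r n] appears both in the entropy of the kernel law and in the joint bound, and cancels;
    the estimate thus holds for each [n], not only in the limit. *)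
Lemma kernel_lawH_ge (B C : finType) (r : seq B -> R) (s : seq C -> R) (g : B * C -> R) n :
    word_law r -> word_law s -> (forall a, 0 <= g a) -> (forall b, \sum_c g (b, c) = 1) ->
    image_law snd (kernel_law r g) s ->
  - (n%:R * \sum_a kernel_law r g [:: a] * log2 (g a)) <= lawH s n.
Proof.
move=> rl sl g0 g1 qs.
have kl := kernel_law_word_law rl g0 g1; have kr := kernel_law_image r g1.
have := lawH_joint n kl rl sl kr qs; rewrite (lawH_kernel_law rl g0 g1); lra.
Qed.

End Subadditive.

(** * Limits of empirical word frequencies *)

Section Empirical.
Variables (R : realType) (A : finType).

(** Occurrences are counted by their starting letter, so the empty word occurs [size u] times and
    has frequency exactly 1. *)
Fixpoint occ (v u : seq A) : nat :=
  if u is x :: u' then (take (size v) u == v) + occ v u' else 0%N.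

Lemma occ_le v u : (occ v u <= size u)%N.
Proof. by elim: u => //= x u IH; rewrite -add1n leq_add// leq_b1. Qed.

Lemma occ_nil u : occ [::] u = size u.
Proof. by elim: u => //= x u ->; rewrite ?take0 ?eqxx. Qed.

(** Only an occurrence that ends with [u] cannot be extended to the right, so at most one is
    lost. *)
Lemma occ_sum_rcons v u :
  (\sum_a occ (rcons v a) u <= occ v u <= \sum_a occ (rcons v a) u + (size v <= size u)%N)%N.
Proof.
have step w : (\sum_a (take (size (rcons v a)) w == rcons v a) =
    ((take (size v) w == v) && (size v < size w)) :> nat)%N.
  have [sw|sw] := ltnP (size v) (size w); last first.
    rewrite andbF big1// => a _; rewrite take_oversize ?size_rcons ?(leqW sw)//.
    by case: eqP => // we; move: sw; rewrite we size_rcons ltnn.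
  rewrite andbT; have [x0] : exists x0 : A, True by case: w sw => // x0; exists x0.
  rewrite (bigD1 (nth x0 w (size v)))//= big1 ?addn0 => [|a aw].
    by rewrite size_rcons (take_nth x0)// eqseq_rcons eqxx andbT.
  by rewrite size_rcons (take_nth x0)// eqseq_rcons eq_sym [nth _ _ _ == _]eq_sym (negPf aw) andbF.
elim: u => [|x u IH]; first by rewrite big1.
have -> : (\sum_a occ (rcons v a) (x :: u) =
    ((take (size v) (x :: u) == v) && (size v < (size u).+1)) + \sum_a occ (rcons v a) u)%N.
  by rewrite -(step (x :: u)) -big_split.
rewrite -[occ v _]/((take (size v) (x :: u) == v) + occ v u)%N; move: IH => /andP[].
set S := (\sum_a _)%N; set o := occ v u.
have [h|h|h] := ltngtP (size v) (size u).+1; rewrite ?andbF ?andbT.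
- rewrite (_ : (size v <= size u)%N); last by rewrite -ltnS.
  by case: eqP => _ /=; lia.
- rewrite take_oversize/=; last by rewrite ltnW.
  have -> : (x :: u == v) = false by apply/eqP => e; move: h; rewrite -e /= ltnn.
  have -> : (size v <= size u)%N = false by rewrite leqNgt (ltn_trans _ h).
  by move=> h1; rewrite /= !addn0 !add0n => h2; rewrite h1 h2.
- rewrite (_ : (size v <= size u)%N = false); last by rewrite h ltnn.
  by case: eqP => _ /=; lia.
Qed.

(** Only an occurrence at the start of [u] cannot be extended to the left. *)
Lemma occ_sum_cons v u :
  (\sum_a occ (a :: v) u <= occ v u <= \sum_a occ (a :: v) u + 1)%N.
Proof.
have step w x : (\sum_a (take (size (a :: v)) (x :: w) == a :: v) = (take (size v) w == v) :> nat)%N.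
  rewrite (bigD1 x)//= eqseq_cons eqxx big1 ?addn0// => a /negPf ax.
  by rewrite eqseq_cons eq_sym ax.
have key x w : (\sum_a occ (a :: v) (x :: w) = occ v w + (v == [::]))%N.
  elim: w x => [|y w IH] x.
    rewrite [LHS]big_split step [X in (_ + X)%N = _]big1 //= addn0 add0n.
    by rewrite [in RHS]eq_sym.
  rewrite [LHS]big_split step IH /=; lia.
case: u => [|x u]; first by rewrite big1.
rewrite key /=; have [->|v0] := eqVneq v [::]; first by rewrite take0 eqxx /=; lia.
by case: eqP => _; lia.
Qed.

Lemma sum_occ1 (f : A -> R) u : \sum_(a <- u) f a = \sum_a (occ [:: a] u)%:R * f a.
Proof.
elim: u => [|x u IH]; first by rewrite big_nil big1// => a _; rewrite mul0r.
rewrite big_cons IH.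
have step a : (occ [:: a] (x :: u))%:R * f a = (x == a)%:R * f a + (occ [:: a] u)%:R * f a.
  by rewrite -mulrDl -natrD /= take0 eqseq_cons andbT.
under [RHS]eq_bigr => a _ do rewrite step.
rewrite [RHS]big_split /=; congr +%R.
rewrite (bigD1 x)//= eqxx mul1r big1 ?addr0// => a /negPf ax.
by rewrite eq_sym ax mul0r.
Qed.

(** * Comparison with a Markov measure generated from right to left *)

Section Backward.
Variables (q : seq A -> R) (k : nat) (eps : R).
Hypotheses (ql : word_law q) (eps0 : 0 < eps) (x0 : A).

Let N : R := #|A|%:R.

Let N0 : 0 < N. Proof. by rewrite ltr0n; apply/card_gt0P; exists x0. Qed.

(* Conditional probability of the first letter given the next [k] ones; the
   perturbation [eps] keeps it positive. *)
Definition bcond (w : seq A) : R :=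
  if size w == k.+1 then (q w + eps) / (q (behead w) + N * eps) else N^-1.

(** The last [k] letters, which lack a full context, are uniform; the earlier ones follow the
    transition probabilities [bcond]. *)
Fixpoint bmeas (u : seq A) : R :=
  if u is x :: u' then bcond (take k.+1 u) * bmeas u' else 1.

Lemma bcond_gt0 w : 0 < bcond w.
Proof.
rewrite /bcond; case: ifP => _; last by rewrite invr_gt0.
have h v : 0 <= q v by exact: law_ge0.
by rewrite divr_gt0// ltr_wpDl// mulr_gt0.
Qed.

Lemma bmeas_gt0 u : 0 < bmeas u.
Proof. by elim: u => //= x u IH; rewrite mulr_gt0// bcond_gt0. Qed.

Lemma bmeas_sum n : wsum n bmeas = 1.
Proof.
elim: n => [|n IH]; first by rewrite wsum0.
rewrite wsumS -wsum_sum -IH; apply: eq_wsum => u _ /=.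
rewrite -mulr_suml -[RHS]mul1r; congr *%R; rewrite /bcond /=.
rewrite eqSS; have [sk|sk] := eqVneq (size (take k u)) k.
  rewrite -mulr_suml big_split /=.
  case: ql => q0 _ -> _; rewrite sumr_const -mulr_natl divff// gt_eqF//.
  by rewrite ltr_wpDl// mulr_gt0.
rewrite sumr_const -mulr_natl divff//.
by rewrite gt_eqF.
Qed.

(** Collecting positions by the word of length [k + 1] read there turns the logarithm into a sum
    over occurrences; each letter without full context costs [log2 N]. *)
Lemma log2_bmeas u :
  - log2 (bmeas u) <= wsum k.+1 (fun v => (occ v u)%:R * - log2 (bcond v)) + (minn (size u) k)%:R * log2 N.
Proof.
elim: u => [|x u IH].
  rewrite log21 oppr0 min0n mul0r addr0 wsum_ge0// => v _.
  by rewrite mul0r.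
rewrite [bmeas _]/= -/(take k.+1 (x :: u)) log2M ?bcond_gt0 ?bmeas_gt0// opprD.
have -> : wsum k.+1 (fun v => (occ v (x :: u))%:R * - log2 (bcond v)) =
   wsum k.+1 (fun v => if v == take k.+1 (x :: u) then - log2 (bcond v) else 0) +
   wsum k.+1 (fun v => (occ v u)%:R * - log2 (bcond v)).
  rewrite -wsumD; apply: eq_wsum => v vk.
  rewrite -[occ v (x :: u)]/((take (size v) (x :: u) == v) + occ v u)%N natrD mulrDl vk eq_sym.
  by case: eqP => _; rewrite ?mul1r ?mul0r.
rewrite -addrA.
have lN : 0 <= log2 N.
  by rewrite /log2 divr_ge0 ?(ltW (ln2_gt0 _))// ln_ge0// ler1n -(ltr0n R).
have [sk|sk] := leqP k.+1 (size u).+1.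
  rewrite wsum_pred1 ?size_takel// lerD2l (le_trans IH)// lerD2l ler_wpM2r// ler_nat.
  by rewrite /=; lia.
have -> : wsum k.+1 (fun v => if v == take k.+1 (x :: u) then - log2 (bcond v) else 0) = 0.
  rewrite -[RHS](mul0r (wsum k.+1 q)) -wsumZ; apply: eq_wsum => v vk; rewrite mul0r.
  case: eqP => // e; move: vk; rewrite e take_oversize/=; last by rewrite ltnW.
  by move=> vk; move: sk; rewrite vk ltnn.
rewrite add0r {1}/bcond take_oversize; last by rewrite /= ltnW.
rewrite (_ : (size (x :: u) == k.+1) = false); last by apply/eqP => /= e; move: sk; rewrite e ltnn.
rewrite log2V// opprK.
have -> : (minn (size (x :: u)) k = (minn (size u) k).+1)%N by rewrite /=; lia.
by rewrite -natr1 mulrDl mul1r; move: IH; lra.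
Qed.

(** For [eps = 0] this would be the conditional entropy of one letter given the next [k]. The
    perturbed numerator only helps; each denominator costs at most [N * eps / ln 2], from
    [ln (1 + t) <= t] with [t = N * eps / q w]. *)
Lemma bcond_entropy :
  wsum k.+1 (fun v => q v * - log2 (bcond v)) <=
  lawH q k.+1 - lawH q k + (@wsum R A k (fun=> 1) * N / ln 2) * eps.
Proof.
have q0 v : 0 <= q v by exact: law_ge0.
have Ne0 : 0 < N * eps by rewrite mulr_gt0.
have -> : wsum k.+1 (fun v => q v * - log2 (bcond v)) =
   wsum k.+1 (fun v => - (q v * log2 (q v + eps))) +
   wsum k.+1 (fun v => q v * log2 (q (behead v) + N * eps)).
  rewrite -wsumD; apply: eq_wsum => v vk; rewrite /bcond vk eqxx.
  by rewrite log2_div ?ltr_wpDl//; ring.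
have le1 : wsum k.+1 (fun v => - (q v * log2 (q v + eps))) <= lawH q k.+1.
  rewrite /lawH -wsumN; apply: ler_wsum => v _; rewrite xlog2xE lerN2.
  have := q0 v; rewrite le_eqVlt => /orP[/eqP <-|qp]; first by rewrite !mul0r.
  by rewrite ler_pM2l// ler_log2// lerDl ltW.
suff : wsum k.+1 (fun v => q v * log2 (q (behead v) + N * eps)) <=
    - lawH q k + (@wsum R A k (fun=> 1) * N / ln 2) * eps by lra.
have -> : wsum k.+1 (fun v => q v * log2 (q (behead v) + N * eps)) =
    wsum k (fun w => q w * log2 (q w + N * eps)).
  rewrite wsumS -wsum_sum; apply: eq_wsum => w _ /=.
  by rewrite -mulr_suml; case: ql => _ _ -> _.
rewrite /lawH opprK.
have -> : @wsum R A k (fun=> 1) * N / ln 2 * eps = @wsum R A k (fun=> N * eps / ln 2).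
  by under [RHS]eq_wsum do rewrite -[_ / _]mulr1; rewrite wsumZ; ring.
rewrite -wsumD; apply: ler_wsum => w _; rewrite xlog2xE.
have l2 := ln2_gt0 R.
have := q0 w; rewrite le_eqVlt => /orP[/eqP <-|qp].
  by rewrite !mul0r add0r divr_ge0// ltW.
rewrite -lerBlDl -mulrBr -log2_div ?addr_gt0// /log2 mulrA ler_pM2r ?invr_gt0//.
rewrite mulrDl divff ?gt_eqF//.
apply: (@le_trans _ _ (q w * (N * eps / q w))); last by rewrite mulrC divfK// gt_eqF.
rewrite ler_pM2l//; have := @ln_le_sub1 R (1 + N * eps / q w).
by rewrite addrAC subrr add0r; apply; rewrite addr_gt0// divr_gt0.
Qed.

End Backward.

End Empirical.

(** * The limit law of the Gibbs weights on a factorial language *)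

Section LimitLaw.
Variables (R : realType) (A : finType) (L : pred (seq A)) (f : A -> R).
Hypothesis Lcat : forall u v, L (u ++ v) -> L u /\ L v.
Hypothesis Lne : forall n, exists2 u, size u = n & L u.

Definition gweight (u : seq A) : R := if L u then 2 `^ (\sum_(a <- u) f a) else 0.
Definition partition_fun n := wsum n gweight.

Lemma gweight_ge0 u : 0 <= gweight u.
Proof. by rewrite /gweight; case: ifP => // _; exact: powR_ge0. Qed.

Lemma partition_fun_gt0 n : 0 < partition_fun n.
Proof.
have [u un Lu] := Lne n; apply: lt_le_trans (wsum_ge gweight_ge0 un).
by rewrite /gweight Lu powR_gt0.
Qed.

Definition gibbs_prob n u := gweight u / partition_fun n.

Definition freq n v := wsum n (fun u => gibbs_prob n u * (occ v u)%:R) / n%:R.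

Lemma gibbs_prob_ge0 n u : 0 <= gibbs_prob n u.
Proof. by rewrite divr_ge0 ?gweight_ge0// ltW// partition_fun_gt0. Qed.

Lemma gibbs_prob_sum n : wsum n (gibbs_prob n) = 1.
Proof.
rewrite /gibbs_prob; under eq_wsum => u _ do rewrite mulrC.
by rewrite wsumZ mulVf// gt_eqF// partition_fun_gt0.
Qed.

Lemma freq_ge0 n v : 0 <= freq n v.
Proof. by rewrite divr_ge0// wsum_ge0// => u _; rewrite mulr_ge0// gibbs_prob_ge0. Qed.

Lemma freqM n v : (0 < n)%N -> n%:R * freq n v = wsum n (fun u => gibbs_prob n u * (occ v u)%:R).
Proof. by move=> n0; rewrite mulrC divfK// pnatr_eq0 -lt0n. Qed.

Lemma freq_nil n : (0 < n)%N -> freq n [::] = 1.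
Proof.
move=> n0; apply: (@mulfI _ n%:R); first by rewrite pnatr_eq0 -lt0n.
rewrite freqM// mulr1 -[RHS]mulr1 -(gibbs_prob_sum n) -wsumZ.
by apply: eq_wsum => u un; rewrite occ_nil un mulrC.
Qed.

Lemma freq_le1 n v : freq n v <= 1.
Proof.
have [->|n0] := posnP n; first by rewrite /freq invr0 mulr0.
have nR : 0 < n%:R :> R by rewrite ltr0n.
rewrite -(freq_nil n0) -(ler_pM2l nR) !freqM//.
apply: ler_wsum => u _; rewrite ler_wpM2l ?gibbs_prob_ge0// ler_nat occ_nil.
exact: occ_le.
Qed.

Lemma freq_sum_near n v (ext : A -> seq A) c :
    (forall u, \sum_a occ (ext a) u <= occ v u <= \sum_a occ (ext a) u + c u)%N ->
    (forall u, c u <= 1)%N -> (0 < n)%N ->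
  \sum_a freq n (ext a) <= freq n v <= \sum_a freq n (ext a) + n%:R^-1.
Proof.
move=> occ_ext c1 n0.
have nR : 0 < n%:R :> R by rewrite ltr0n.
have sumE : n%:R * (\sum_a freq n (ext a)) = wsum n (fun u => gibbs_prob n u * (\sum_a occ (ext a) u)%:R).
  rewrite mulr_sumr; under eq_bigr => a _ do rewrite freqM//.
  by rewrite -wsum_sum; apply: eq_wsum => u _; rewrite natr_sum mulr_sumr.
apply/andP; split; rewrite -(ler_pM2l nR) freqM ?mulrDr ?mulfV ?gt_eqF// sumE.
  apply: ler_wsum => u _; rewrite ler_wpM2l ?gibbs_prob_ge0// ler_nat.
  by case/andP: (occ_ext u).
rewrite -[X in _ <= _ + X](gibbs_prob_sum n) -wsumD; apply: ler_wsum => u _.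
apply: le_trans (_ : gibbs_prob n u * (\sum_a occ (ext a) u).+1%:R <= _); last first.
  by rewrite -natr1 mulrDr mulr1.
rewrite ler_wpM2l ?gibbs_prob_ge0// ler_nat.
by case/andP: (occ_ext u) => _; have := c1 u; lia.
Qed.

Lemma freq_notin n v : ~~ L v -> freq n v = 0.
Proof.
move=> Lv; rewrite /freq (_ : wsum _ _ = 0) ?mul0r//.
rewrite -[RHS](mul0r (wsum n gweight)) -wsumZ; apply: eq_wsum => u _.
rewrite mul0r /gibbs_prob /gweight; case: ifP => Lu; last by rewrite !mul0r.
suff -> : occ v u = 0%N by rewrite mulr0.
elim: u Lu => //= x u IH Lxu; rewrite IH ?addn0.
  case: eqP => // e; move: Lv; rewrite -e.
  by have [|-> //] := @Lcat (take (size v) (x :: u)) (drop (size v) (x :: u)); rewrite ?cat_take_drop.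
by have [] := @Lcat [:: x] u Lxu.
Qed.

Lemma letter_exists : exists x0 : A, true.
Proof. by have [[//|x0 ?] _ _] := Lne 1; exists x0. Qed.

(** Gibbs' inequality for [gibbs_prob] against [bmeas]. The entropy of [gibbs_prob] is [log2] of the
    partition function minus the mean energy; apart from the boundary term, the bound is linear in
    the frequencies. *)
Lemma log2_partition_fun_le (q : seq A -> R) k eps n :
    word_law q -> 0 < eps -> (0 < n)%N ->
  log2 (partition_fun n) / n%:R <= \sum_a freq n [:: a] * f a +
    wsum k.+1 (fun v => freq n v * - log2 (bcond q k eps v)) +
    (k%:R * log2 (#|A|%:R)) / n%:R.
Proof.
move=> ql eps0 n0; have nR : 0 < n%:R :> R by rewrite ltr0n.
have [x0 _] := letter_exists.
have P0 := gibbs_prob_ge0 n.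
have [||||u _ /eqP|le_ _] := @wgibbs R A n (gibbs_prob n) (bmeas q k eps).
- exact: P0.
- by move=> u; rewrite ltW// bmeas_gt0.
- exact: gibbs_prob_sum.
- by rewrite bmeas_sum.
- by rewrite gt_eqF// bmeas_gt0.
rewrite ler_pdivrMr//.
have entE : - wsum n (fun u => xlog2x (gibbs_prob n u)) =
    log2 (partition_fun n) - wsum n (fun u => gibbs_prob n u * \sum_(a <- u) f a).
  rewrite -[log2 _]mulr1 -(gibbs_prob_sum n) -wsumZ -!wsumN -wsumD.
  apply: eq_wsum => u _; rewrite xlog2xE /gibbs_prob /gweight; case: ifP => Lu; last by rewrite !mul0r; ring.
  by rewrite log2_div ?powR_gt0 ?partition_fun_gt0// log2_powR; ring.
have {}le_ : log2 (partition_fun n) <= wsum n (fun u => gibbs_prob n u * (\sum_(a <- u) f a - log2 (bmeas q k eps u))).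
  under eq_wsum => u _ do rewrite mulrBr.
  by rewrite wsumD wsumN; move: le_; rewrite entE; lra.
apply: (le_trans le_).
have lN : 0 <= log2 #|A|%:R :> R.
  rewrite /log2 divr_ge0 ?(ltW (ln2_gt0 _))// ln_ge0// ler1n; apply/card_gt0P.
  by exists x0.
apply: (@le_trans _ _ (wsum n (fun u => gibbs_prob n u *
    (\sum_a (occ [:: a] u)%:R * f a +
     wsum k.+1 (fun v => (occ v u)%:R * - log2 (bcond q k eps v)) + k%:R * log2 #|A|%:R)))).
  apply: ler_wsum => u _; rewrite ler_wpM2l// -sum_occ1 -addrA lerD2l.
  apply: (le_trans (log2_bmeas k ql eps0 x0 u)); rewrite lerD2l ler_wpM2r// ler_nat.
  exact: geq_minr.
under eq_wsum => u _ do rewrite !mulrDr.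
rewrite !wsumD le_eqVlt; apply/orP; left; apply/eqP.
rewrite [RHS]mulrDl [in RHS]mulrDl divfK ?gt_eqF//; congr (_ + _ + _).
- rewrite mulr_suml.
  under eq_wsum => u _ do rewrite mulr_sumr.
  rewrite wsum_sum; apply: eq_bigr => a _.
  rewrite [RHS]mulrC mulrA freqM// mulrC -wsumZ.
  by apply: eq_wsum => u _; ring.
- rewrite [RHS]mulrC -wsumZ.
  under [RHS]eq_wsum => v _ do rewrite mulrA freqM// mulrC -wsumZ.
  rewrite exchange_wsum; apply: eq_wsum => u _.
  by rewrite -wsumZ; apply: eq_wsum => v _; ring.
- under eq_wsum => u _ do rewrite mulrC.
  by rewrite wsumZ gibbs_prob_sum mulr1.
Qed.

Variable U : set_system nat.
Hypotheses (UU : UltraFilter U) (ooU : \oo `<=` U).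

Lemma ultra_bounded_cvg (a : nat -> R) : (forall n, 0 <= a n <= 1) ->
  exists p : R, a n @[n --> U] --> p.
Proof.
move=> a01.
have Fa : fmap a U `[0%R, 1%R]%classic.
  apply: (@filterS _ U _ setT); last exact: filterT.
  by move=> n _ /=; rewrite in_itv /= a01.
(* Compactness gives a cluster point, and a cluster point of an ultrafilter is a limit. *)
have [p [_ clp]] := segment_compact _ Fa.
exists p => N Np; have [//|UN] := in_ultra_setVsetC (a @^-1` N) UU.
by have [y []] := clp (~` N) N UN Np.
Qed.

Lemma cvg_wsum m (F : nat -> seq A -> R) (G : seq A -> R) :
  (forall v, F n v @[n --> U] --> G v) -> wsum m (F n) @[n --> U] --> wsum m G.
Proof. by move=> FG; apply: cvg_big => [|v _]; [exact: add_continuous|exact: FG]. Qed.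

(** The limit [q] itself serves as the law behind [bmeas]: letting [n] run along [U] and then [eps]
    tend to 0 bounds each increment of [lawH q] below by [x] minus the mean energy. *)
Theorem limit_law : exists q : seq A -> R,
  [/\ word_law q, forall u, ~~ L u -> q u = 0 &
    forall x, (\forall n \near U, x <= log2 (partition_fun n) / n%:R) ->
    forall m, m%:R * (x - \sum_a q [:: a] * f a) <= lawH q m].
Proof.
have near0 : \forall n \near U, (0 < n)%N by apply: ooU; exact: nbhs_infty_gt.
have /choice[q qE] : forall v, exists p : R, freq n v @[n --> U] --> p.
  by move=> v; apply: ultra_bounded_cvg => n; rewrite freq_ge0 freq_le1.
have cvgn0 : (n%:R^-1 : R) @[n --> U] --> (0 : R).
  apply/cvgrPdist_lt => e e0; near=> n.
  have en : e^-1 < n%:R.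
    by near: n; apply: ooU; exact: nbhs_infty_gtr.
  have nR : 0 < n%:R :> R by rewrite (lt_trans _ en)// invr_gt0.
  by rewrite sub0r normrN ger0_norm ?invr_ge0// -(invrK e) ltf_pV2 ?posrE ?invr_gt0.
have cvgsum (ext : A -> seq A) : \sum_a freq n (ext a) @[n --> U] --> \sum_a q (ext a).
  by apply: cvg_big => [|v _]; [exact: add_continuous|exact: qE].
have limsum v (ext : A -> seq A) c :
    (forall u, \sum_a occ (ext a) u <= occ v u <= \sum_a occ (ext a) u + c u)%N ->
    (forall u, c u <= 1)%N -> \sum_a q (ext a) = q v.
  move=> h c1; apply/eqP; rewrite eq_le; apply/andP; split.
    apply: (ler_cvg_to (cvgsum ext) (qE v)); near=> n.
    have n0 : (0 < n)%N by near: n.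
    by have /andP[] := freq_sum_near h c1 n0.
  rewrite -[leRHS]addr0; apply: (ler_cvg_to (qE v) (cvgD (cvgsum ext) cvgn0)); near=> n.
  have n0 : (0 < n)%N by near: n.
  by have /andP[] := freq_sum_near h c1 n0.
have ql : word_law q.
  split.
  - by move=> u; apply: (cvgr_to_ge (qE u)); apply: nearW => n; exact: freq_ge0.
  - apply/eqP; rewrite eq_le; apply/andP; split.
      by apply: (cvgr_to_le (qE [::])); apply: nearW => n; exact: freq_le1.
    apply: (cvgr_to_ge (qE [::])); near=> n; rewrite freq_nil//; near: n; exact: near0.
  - by move=> u; apply: (limsum _ _ (fun=> 1%N)) => // v; exact: occ_sum_cons.
  - move=> u; apply: (limsum _ _ (fun v => (size u <= size v)%N : nat)) => [v|v].
      exact: occ_sum_rcons.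
    exact: leq_b1.
exists q; split=> //.
  move=> u Lu; apply/eqP; rewrite eq_le (law_ge0 ql) andbT.
  by apply: (cvgr_to_le (qE u)); apply: nearW => n; rewrite freq_notin.
move=> x xle; set e := \sum_a _.
have incr k : x - e <= lawH q k.+1 - lawH q k.
  have C0 : 0 <= @wsum R A k (fun=> 1) * #|A|%:R / ln 2.
    by rewrite divr_ge0 ?(ltW (ln2_gt0 _))// mulr_ge0// wsum_ge0.
  apply/ler_addgt0Pr => d d0.
  (* Chosen so that the error term of [bcond_entropy] is at most [d]; the added 1 keeps the
     denominator positive. *)
  pose eps := d / (@wsum R A k (fun=> 1) * #|A|%:R / ln 2 + 1).
  have eps0 : 0 < eps by rewrite divr_gt0// ltr_wpDl.
  have [x0 _] := letter_exists.
  have Cd : (@wsum R A k (fun=> 1) * #|A|%:R / ln 2) * eps <= d.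
    rewrite /eps mulrA mulrAC ler_piMl ?(ltW d0)//.
    by rewrite ler_pdivrMr ?ltr_wpDl// mul1r lerDl.
  have := bcond_entropy k ql eps0 x0.
  have : x <= e + wsum k.+1 (fun v => q v * - log2 (bcond q k eps v)) + (k%:R * log2 (#|A|%:R)) * 0.
    have c1 : \sum_a freq n [:: a] * f a @[n --> U] --> e.
      apply: (@cvg_big _ _ _ _ _ _ _ _ _ (fun a n => freq n [:: a] * f a)) => [|a _].
        exact: add_continuous.
      by apply: cvgM; [exact: qE|exact: cvg_cst].
    have c2 : wsum k.+1 (fun v => freq n v * - log2 (bcond q k eps v)) @[n --> U] -->
        wsum k.+1 (fun v => q v * - log2 (bcond q k eps v)).
      apply: (@cvg_wsum k.+1 (fun n v => freq n v * - log2 (bcond q k eps v))) => v.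
      by apply: cvgM; [exact: qE|exact: cvg_cst].
    have c3 : (k%:R * log2 (#|A|%:R)) / n%:R @[n --> U] --> (k%:R * log2 (#|A|%:R)) * (0 : R).
      by apply: cvgM; [exact: cvg_cst|exact: cvgn0].
    apply: (cvgr_to_ge (cvgD (cvgD c1 c2) c3)).
    near=> n; apply: le_trans (_ : log2 (partition_fun n) / n%:R <= _).
      by near: n.
    by apply: log2_partition_fun_le => //; near: n.
  by rewrite mulr0; move: Cd; lra.
elim=> [|m IH]; first by rewrite mul0r (lawH_ge0 ql).
by rewrite -natr1 mulrDl mul1r; have := incr m; lra.
Unshelve. all: end_near.
Qed.

End LimitLaw.

(** * Invariant measures on subshifts *)

Section Measures.
Variable R : realType.

(** [entropy] is a [limn], informative only once convergence is known; subadditivity provides it. *)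
Lemma entropy_cvg (A : PFin.type) (mu : probability (ShiftSpace A) R) : invariant mu ->
  lawH (law mu) n / n%:R @[n --> \oo] --> entropy mu.
Proof.
move=> /law_word_law ml.
have [l cl _] := fekete (lawH_ge0 ml) (fun m n => lawH_subadditive m n ml).
by rewrite /entropy -[blockH mu]/(lawH (law mu)) (cvg_lim _ cl).
Qed.

Lemma law_letter_map (A B : PFin.type) (F : A -> B)
    (lam : probability (ShiftSpace A) R) (mu : probability (ShiftSpace B) R) :
  meq mu (pushforward lam ((fun x i => F (x i)) : ShiftSpace A -> ShiftSpace B)) -> image_law F (law lam) (law mu).
Proof.
move=> muE v; apply: (@image_cyl R A B F lam mu _ 0 v) => m w.
by rewrite muE; last exact: measurable_cyl.
Qed.

Lemma meq_law (A : PFin.type) (mu : probability (ShiftSpace A) R)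
    (nu : {measure set (ShiftSpace A) -> \bar R}) :
  invariant mu -> (forall m u, nu (cyl m u) = (law mu u)%:E) -> meq mu nu.
Proof.
move=> mi munu B mB; apply: measure_unique_cyl mB => [|m u].
  by rewrite -ge0_fin_numE// fin_num_measure.
by apply: (etrans (invariant_cyl mi m u)); rewrite munu.
Qed.

Lemma integ_letter (mu : probability (ShiftSpace bool) R) (f : bool -> R) :
  integ mu (fun x => f (x 0)) = \sum_b law mu [:: b] * f b.
Proof.
have cE b : cyl 0 [:: b] = [set x : ShiftSpace bool | x 0 = b].
  apply/seteqP; split => x /=; rewrite /cyl /win /= addr0; first by case.
  by move=> ->.
have mf (D : set (ShiftSpace bool)) : measurable_fun D (fun x : ShiftSpace bool => f (x 0)).
  move=> mD Y _; apply: measurableI => //.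
  rewrite (_ : _ @^-1` _ = [set x : ShiftSpace bool | [set w | Y (f (head false w))] (win x 0 1)]).
    exact: measurable_win.
  by apply/seteqP; split => x /=; rewrite addr0.
have TE : setT = cyl 0 [:: true] `|` cyl 0 [:: false] :> set (ShiftSpace bool).
  apply/seteqP; split => x // _; rewrite !cE /=.
  by case: (x 0); [left|right].
have int1 b : (\int[mu]_(x in cyl 0 [:: b]) (f (x 0))%:E = (law mu [:: b] * f b)%:E)%E.
  rewrite (eq_integral (cst (f b)%:E)) => [|x]; last by rewrite inE cE /= => ->.
  rewrite integral_cst; last exact: measurable_cyl.
  by rewrite EFinM muleC /law fineK// fin_num_cyl.
rewrite /integ TE integral_setU.
- by rewrite !int1 -EFinD /= big_bool.
- exact: measurable_cyl.
- exact: measurable_cyl.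
- by apply/measurable_EFinP; exact: mf.
- by apply/disj_setPS => x [] /=; rewrite !cE /= => ->.
Qed.

(** * The language of a subshift, and measures carried by it *)

Section Language.
Variable X : set (int -> bool).
Hypothesis sX : subshift X.

Definition in_language (u : seq bool) : bool :=
  `[< exists2 x, X x & win x 0 (size u) = u >].

Lemma inL_language n (u : n.-tuple bool) : inL X u = in_language u.
Proof. by rewrite /inL /in_language size_tuple. Qed.

Lemma subshift_translate x (m : int) : X x -> exists2 y, X y & forall i, y i = x (i + m).
Proof.
have [_ XE _] := sX.
have fwd n z : X z -> exists2 y, X y & forall i, y i = z (i + n%:Z).
  elim: n z => [|n IH] z Xz; first by exists z => // i; rewrite addr0.
  have [y Xy yE] := IH z Xz; exists (shift y); first by rewrite -XE; exists y.
  by move=> i; rewrite /shift yE; congr z; lia.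
have bwd n z : X z -> exists2 y, X y & forall i, y i = z (i - n%:Z).
  elim: n z => [|n IH] z Xz; first by exists z => // i; rewrite subr0.
  have [y Xy yE] := IH z Xz; have [t Xt ty] : (shift @` X) y by rewrite XE.
  exists t => // i; rewrite -[i](subrK 1) -[t _]/(shift t (i - 1)) ty yE.
  by congr z; lia.
move=> Xx; case: (leP 0 m) => m0.
  by have [y Xy yE] := fwd `|m|%N x Xx; exists y => // i; rewrite yE; congr x; lia.
by have [y Xy yE] := bwd `|m|%N x Xx; exists y => // i; rewrite yE; congr x; lia.
Qed.

Lemma in_languageP u (m : int) :
  reflect (exists2 x, X x & win x m (size u) = u) (in_language u).
Proof.
have tr (a b : int) : (exists2 x, X x & win x a (size u) = u) ->
    exists2 x, X x & win x b (size u) = u.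
  move=> [x Xx xu]; have [y Xy yE] := subshift_translate (a - b) Xx; exists y => //.
  by rewrite -[RHS]xu; apply: eq_map => i; rewrite yE; congr x; lia.
by rewrite /in_language; apply: (iffP (asboolP _)); exact: tr.
Qed.

Lemma in_language_cat u v : in_language (u ++ v) -> in_language u /\ in_language v.
Proof.
move=> /(in_languageP _ 0)[x Xx]; rewrite size_cat win_cat => /eqP.
rewrite eqseq_cat ?size_win// => /andP[/eqP xu /eqP xv].
by split; apply/in_languageP; exists x => //; [exact: xu|exact: xv].
Qed.

Lemma in_language_ex n : exists2 u, size u = n & in_language u.
Proof.
have [[x Xx] _ _] := sX; exists (win x 0 n); first exact: size_win.
by apply/(in_languageP _ 0); exists x => //; rewrite size_win.
Qed.

(** Closedness: a point outside [X] shows a forbidden word in some central window. The countable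
    union yields measurability of [X] and null complements. *)
Lemma subshift_bigcap :
  ~` X = \bigcup_n [set x | ~~ in_language (win x (- n%:Z) n.*2.+1)].
Proof.
have [_ _ clX] := sX; apply/seteqP; split => x /=; last first.
  move=> [n _ /= /negP xn] Xx; apply: xn; apply/(in_languageP _ (- n%:Z)).
  by exists x => //; rewrite size_win.
move=> nXx; apply: contrapT => h; apply: nXx; apply: clX => n.
apply: contrapT => no; apply: h; exists n => //=; apply/negP => /(in_languageP _ (- n%:Z)).
by rewrite size_win => -[y Xy yE]; apply: no; exists y.
Qed.

Lemma measurable_subshift : measurable (X : set (ShiftSpace bool)).
Proof.
rewrite -[X]setCK; apply: measurableC; rewrite subshift_bigcap.
apply: bigcupT_measurable => n.
exact: (measurable_win (- n%:Z) n.*2.+1 [set w | ~~ in_language w]).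
Qed.

Lemma law_notin_language (mu : probability (ShiftSpace bool) R) u :
  inM X mu -> ~~ in_language u -> law mu u = 0.
Proof.
move=> [_ muX] uL; rewrite /law; suff -> : mu (cyl 0 u) = 0%E by [].
apply/eqP; rewrite eq_le measure_ge0 andbT.
have <- : mu (~` X) = 0%E.
  by rewrite probability_setC ?muX ?subee//; exact: measurable_subshift.
apply: le_measure; rewrite ?inE; [exact: measurable_cyl|apply: measurableC; exact: measurable_subshift|].
move=> x xu Xx; move: uL => /negP; apply.
by apply/(in_languageP _ 0); exists x.
Qed.

Lemma inM_law (mu : probability (ShiftSpace bool) R) :
  invariant mu -> (forall u, ~~ in_language u -> law mu u = 0) -> inM X mu.
Proof.
move=> mi mu0; split=> //.
have mXC : measurable (~` X : set (ShiftSpace bool)) by apply: measurableC; exact: measurable_subshift.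
suff : mu (~` X) = 0%E.
  move=> h; rewrite -[X]setCK probability_setC// h sube0//.
apply/negligibleP => //; rewrite subshift_bigcap; apply: negligible_bigcup => n.
pose k := n.*2.+1; set E := [set x | _].
have mE : measurable (E : set (ShiftSpace bool)).
  exact: (measurable_win (- n%:Z) k [set w | ~~ in_language w]).
apply/negligibleP => //.
pose g (x : ShiftSpace bool) : k.-tuple bool := Tuple (introT eqP (size_win x (- n%:Z) k)).
have fib (t : k.-tuple bool) : E `&` [set x | g x = t] =
    (if ~~ in_language t then cyl (- n%:Z) t else set0).
  apply/seteqP; split => x /=.
    move=> [Ex <-]; rewrite ifT//.
    by change (win x (- n%:Z) (size (g x)) = g x :> seq bool); rewrite size_tuple.
  case: ifP => // tL; rewrite /cyl /= size_tuple => xt; split.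
    by rewrite /E /= -/k xt.
  exact: val_inj.
have mfib t : measurable (E `&` [set x | g x = t] : set (ShiftSpace bool)).
  by rewrite fib; case: ifP => _; [exact: measurable_cyl|exact: measurable0].
apply: (etrans (measure_fibers mu mfib)); rewrite big1// => t _; rewrite fib; case: ifP => tL; last by rewrite measure0.
by apply: (etrans (invariant_cyl mi _ _)); rewrite mu0.
Qed.

Lemma pressure_term (f : bool -> R) n :
  \sum_(u : n.-tuple bool | inL X u)
     (2 : R) `^ (sup [set (\sum_(j < n) f ((iter j shift x) 0)) | x in X `&` cyl 0 (tval u)])
  = partition_fun in_language f n.
Proof.
rewrite /partition_fun /wsum big_mkcond /=; apply: eq_bigr => u _.
rewrite inL_language /gweight; case: ifP => // uL; congr (_ `^ _).
have iterE j (x : int -> bool) i : iter j shift x i = x (i + j%:Z).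
  by elim: j i => [|j IH] i /=; rewrite ?addr0// /shift IH; congr x; lia.
(* The potential reads one coordinate, so its Birkhoff sum is constant on the cylinder and the
   supremum is over a singleton. *)
rewrite (_ : [set _ | _ in _] = [set \sum_(a <- u) f a]) ?sup1//.
have sumE (x : int -> bool) : win x 0 (size u) = u -> \sum_(j < n) f (iter j shift x 0) = \sum_(a <- u) f a.
  move=> xu; rewrite -[in RHS]xu /win big_map size_tuple.
  have -> : iota 0 n = index_iota 0 n by rewrite /index_iota subn0.
  rewrite big_mkord.
  by apply: eq_bigr => j _; rewrite iterE.
apply/seteqP; split => y /=.
  by move=> [x [Xx xu] <-]; apply: sumE.
move=> ->; have /(in_languageP _ 0)[x Xx xu] := uL.
by exists x => //; apply: sumE.
Qed.

End Language.

End Measures.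

(** * Sandwich subordinate subshifts *)

Section Kernel.
Variable R : realType.

Definition sandwich_map (t : Bool3) : Bool3 := (t.1, if t.2 then t.1.2 else t.1.1).

Definition coin (p : R) (b : bool) : R := if b then 1 - p else p.

(* Conditional probability that [N(w, x, y) = z] when [y] is a [coin p]. *)
Definition sandwich_kernel (p : R) (a : Bool3) : R :=
  \sum_y (if (if y then a.1.2 else a.1.1) == a.2 then coin p y else 0).

Lemma sandwich_kernel_map p (r : seq Bool2 -> R) :
  image_law sandwich_map (kernel_law r (fun t => coin p t.2))
    (kernel_law r (sandwich_kernel p)).
Proof.
have := @kernel_law_map R _ _ _ sandwich_map r (fun t => coin p t.2) (fun=> erefl).
rewrite (_ : (fun a => \sum_t if sandwich_map t == a then coin p t.2 else 0) = sandwich_kernel p)//.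
apply/funext => -[a z].
transitivity (\sum_b \sum_y (if sandwich_map (b, y) == (a, z) then coin p y else 0)).
  by rewrite pair_bigA /=; apply: eq_bigr => -[].
rewrite (bigD1 a)//= [X in _ + X]big1 ?addr0 => [|b /negPf ba].
  by rewrite /sandwich_kernel; apply: eq_bigr => y _; rewrite xpair_eqE eqxx.
by rewrite big1// => y _; rewrite xpair_eqE ba.
Qed.

Lemma coin_sum (B : finType) p (b : B) :
  \sum_c (fun t : B * bool => coin p t.2) (b, c) = 1.
Proof. by rewrite big_bool /=; lra. Qed.

Lemma sandwich_kernel_sum p b : \sum_z sandwich_kernel p (b, z) = 1.
Proof.
rewrite exchange_big /= -(coin_sum p true); apply: eq_bigr => y _.
by rewrite big_bool; case: (if y then _ else _) => /=; rewrite ?addr0 ?add0r.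
Qed.

Lemma sum_bool3 (F : Bool3 -> R) : \sum_a F a = \sum_w \sum_x \sum_z F ((w, x), z).
Proof. by rewrite [RHS]pair_bigA /= [RHS]pair_bigA /=; apply: eq_bigr => -[[]]. Qed.

Lemma image_fst1 (B C : finType) (q : seq (B * C) -> R) r b :
  image_law fst q r -> r [:: b] = \sum_c q [:: (b, c)].
Proof.
move=> ->; rewrite wsumS; under eq_bigr do rewrite wsum0.
transitivity (\sum_b' \sum_c (if [:: b'] == [:: b] then q [:: (b', c)] else 0)).
  by rewrite pair_bigA /=; apply: eq_bigr => -[].
rewrite (bigD1 b)//= eqxx [X in _ + X]big1 ?addr0// => b' /negPf bb.
by rewrite big1// => c _; rewrite eqseq_cons bb.
Qed.

Lemma image_snd1 (B C : finType) (q : seq (B * C) -> R) s c :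
  image_law snd q s -> s [:: c] = \sum_b q [:: (b, c)].
Proof.
move=> ->; rewrite wsumS; under eq_bigr do rewrite wsum0.
transitivity (\sum_b \sum_c' (if [:: c'] == [:: c] then q [:: (b, c')] else 0)).
  by rewrite pair_bigA /=; apply: eq_bigr => -[].
apply: eq_bigr => b _; rewrite (bigD1 c)//= eqxx big1 ?addr0// => c' /negPf cc.
by rewrite eqseq_cons cc.
Qed.

Section Weights.
Variable f : bool -> R.
Let Q := 2 `^ f false + 2 `^ f true : R.
Let p := 2 `^ f false / Q.

Let Q0 : 0 < Q. Proof. by rewrite addr_gt0// powR_gt0. Qed.

Let pC : 1 - p = 2 `^ f true / Q.
Proof.
apply: (canRL (mulfK (lt0r_neq0 Q0))).
by rewrite mulrBl mul1r /p divfK ?lt0r_neq0// /Q addrC addKr.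
Qed.

Lemma coin_gt0 b : 0 < coin p b.
Proof. by rewrite /coin pC; case: b; rewrite divr_gt0// powR_gt0. Qed.

Lemma log2_coin b : log2 (coin p b) = f b - log2 Q.
Proof. by rewrite /coin pC; case: b; rewrite log2_div ?powR_gt0// log2_powR. Qed.

Lemma sandwich_kernel_ge0 a : 0 <= sandwich_kernel p a.
Proof. by apply: sumr_ge0 => y _; case: ifP => // _; rewrite ltW// coin_gt0. Qed.

(** Both faces of the coin have positive probability, so the kernel charges every triple that can
    occur; this is the domination needed in Gibbs' inequality. *)
Lemma sandwich_kernel_gt0 t : 0 < sandwich_kernel p (sandwich_map t).
Proof.
rewrite /sandwich_kernel (bigD1 t.2)//= eqxx ltr_wpDr ?coin_gt0//.
by apply: sumr_ge0 => y _; case: ifP => // _; rewrite ltW// coin_gt0.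
Qed.

(** Where [w = x] the kernel is 1 on the only possible [z = w], leaving [f w]. On [(0, 1)] its
    logarithm is [f z - log2 Q], the energy cancels and [log2 Q] is left. The pair [(1, 0)] has no
    mass. *)
Lemma sandwich_energy (q : seq Bool3 -> R) r s :
    word_law q -> image_law fst q r -> image_law snd q s ->
    (forall a, 0 < q [:: a] -> 0 < sandwich_kernel p a) -> r [:: (true, false)] = 0 ->
  - (\sum_a q [:: a] * log2 (sandwich_kernel p a)) + \sum_b s [:: b] * f b =
  r [:: (false, false)] * f false + r [:: (true, true)] * f true +
  r [:: (false, true)] * log2 Q.
Proof.
move=> ql qr qs dom.
have lf := log2_coin false; have lt := log2_coin true.
have q0 a : ~~ (0 < sandwich_kernel p a) -> q [:: a] = 0.
  move=> na; apply/eqP; rewrite eq_le (law_ge0 ql) andbT leNgt.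
  by apply: contra na => /dom.
have k0 w : sandwich_kernel p ((w, w), ~~ w) = 0.
  by rewrite /sandwich_kernel big_bool; case: w => /=; rewrite addr0.
have qff : q [:: (false, false, true)] = 0 by apply: q0; rewrite (k0 false) ltxx.
have qtt : q [:: (true, true, false)] = 0 by apply: q0; rewrite (k0 true) ltxx.
have k1 w : log2 (sandwich_kernel p ((w, w), w)) = 0.
  by rewrite /sandwich_kernel big_bool; case: w => /=; rewrite /coin subrK log21.
have kf : sandwich_kernel p ((false, true), false) = coin p false.
  by rewrite /sandwich_kernel big_bool /= add0r.
have kt : sandwich_kernel p ((false, true), true) = coin p true.
  by rewrite /sandwich_kernel big_bool /= addr0.
rewrite !(image_fst1 _ qr) sum_bool3 !big_bool !(image_snd1 _ qs).
have pairsum (F : Bool2 -> R) : \sum_b F b = F (true, true) + F (true, false) + (F (false, true) + F (false, false)).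
  transitivity (\sum_w \sum_x F (w, x)); last by rewrite !big_bool.
  by rewrite pair_bigA /=; apply: eq_bigr => -[].
rewrite !pairsum /= => r10.
have := law_ge0 ql [:: (true, false, true)]; have := law_ge0 ql [:: (true, false, false)].
move=> h1 h2.
have -> : q [:: (true, false, true)] = 0 by lra.
have -> : q [:: (true, false, false)] = 0 by lra.
by rewrite (k1 true) (k1 false) kf kt lf lt qff qtt; ring.
Qed.

End Weights.

End Kernel.

(** * Pressure and equilibrium states of a sandwich subshift *)

Section Sandwich.
Variables (R : realType) (X : set (int -> bool)) (rho : probability (ShiftSpace Bool2) R).
Hypotheses (sX : subshift X) (sand : sandwich X rho).
Hypotheses (base : base_measure rho) (h0 : entropy rho = 0).
Variable f : bool -> R.

Let phi := fun x : int -> bool => f (x 0).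
Let Q := 2 `^ f false + 2 `^ f true : R.
Let p := 2 `^ f false / Q.
Let r := law rho.
Let P := rho2 rho false false * f false + rho2 rho true true * f true +
         rho2 rho false true * log2 Q.
Let g := sandwich_kernel p.

Let rl : word_law r. Proof. by apply: law_word_law; case: sand. Qed.

Let rrate : lawH r n / n%:R @[n --> \oo] --> (0 : R).
Proof. by rewrite -h0; apply: entropy_cvg; case: sand. Qed.

Let g0 a : 0 <= g a. Proof. exact: sandwich_kernel_ge0. Qed.
Let g1 b : \sum_z g (b, z) = 1. Proof. exact: sandwich_kernel_sum. Qed.

Lemma base_law : r [:: (true, false)] = 0.
Proof.
pose ok (w : seq Bool2) : Prop := all (fun a : Bool2 => a.1 ==> a.2) w.
have okP (z : ShiftSpace Bool2) (m : int) n : ok (win z m n) <->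
    forall j, (j < n)%N -> (z (m + j%:Z)).1 ==> (z (m + j%:Z)).2.
  rewrite /ok /win all_map; split=> [/allP h j jn|h]; first by apply: h; rewrite mem_iota.
  by apply/allP => j; rewrite mem_iota => /andP[_ jn]; apply: h.
(* Measurability of this event is needed to pass to its complement. *)
have ME : [set z : ShiftSpace Bool2 | forall i, (z i).1 ==> (z i).2] =
    \bigcap_n [set z | ok (win z (- n%:Z) n.*2.+1)].
  apply/seteqP; split => z h; first by move=> n _; apply/okP => j _; exact: h.
  move=> i; have /okP/(_ `|(i + `|i|%:Z)%R|%N) := h `|i|%N I.
  have -> : - `|i|%:Z + `|(i + `|i|%:Z)%R|%:Z = i by lia.
  by apply; lia.
have mM : measurable (\bigcap_n [set z : ShiftSpace Bool2 | ok (win z (- n%:Z) n.*2.+1)]).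
  by apply: bigcapT_measurable => n; exact: measurable_win.
rewrite /r /law; suff -> : rho (cyl 0 [:: (true, false)]) = 0%E by [].
apply/eqP; rewrite eq_le measure_ge0 andbT.
have <- : rho (~` [set z : ShiftSpace Bool2 | forall i, (z i).1 ==> (z i).2]) = 0%E.
  rewrite probability_setC; last by rewrite ME.
  by move: base; rewrite /base_measure => ->; rewrite subee.
apply: le_measure; rewrite ?inE; [exact: measurable_cyl|by rewrite ME; apply: measurableC|].
by move=> z; rewrite /cyl /win /= addr0 => -[z0] /(_ 0); rewrite z0.
Qed.

Let letterN : Bool3 -> bool := fun t => if t.2 then t.1.2 else t.1.1.

(** [q] is the law of [(w, x, N(w, x, y))]; it lives on images of [sandwich_map], which gives the
    last clause. *)
Lemma sandwich_lift mu : inM X mu -> exists q : seq Bool3 -> R,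
  [/\ word_law q, image_law fst q r, image_law snd q (law mu) &
      forall u a, a \in u -> 0 < q u -> 0 < g a].
Proof.
move=> /sand.2[lam [li lr lm]].
have ll := law_word_law li.
pose q v := wsum (size v) (fun u => if map (@sandwich_map) u == v then law lam u else 0).
have qE : image_law sandwich_map (law lam) q by [].
exists q; split.
- exact: (image_word_law ll qE).
- apply: (image_law_comp qE).
  exact: (@law_letter_map R Bool3 Bool2 (fst \o sandwich_map) lam rho lr).
- apply: (image_law_comp qE).
  exact: (@law_letter_map R Bool3 bool letterN lam mu lm).
- move=> u a au /(image_law_neq0 ll qE)[w wu _].
  by move: au; rewrite -wu => /mapP[t _ ->]; exact: sandwich_kernel_gt0.
Qed.

(** In the equality case the joint law is the kernel law, whose second marginal does not depend on
    [mu]; this gives uniqueness. *)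
Lemma entropy_integ_le mu : inM X mu ->
  entropy mu + integ mu phi <= P /\
  (entropy mu + integ mu phi = P -> image_law snd (kernel_law r g) (law mu)).
Proof.
move=> muX; have [q [ql qr qs dom]] := sandwich_lift muX.
have := @sandwich_energy R f q r (law mu) ql qr qs.
rewrite -/Q -/p -/g => /(_ _ base_law) e.
have {e} : - (\sum_a q [:: a] * log2 (g a)) + \sum_b law mu [:: b] * f b = P.
  by apply: e => a; apply: dom; rewrite mem_head.
rewrite /phi integ_letter => eP.
have [le_ eq_] := lawH_rate_le ql rl qr qs g0 g1 rrate dom (entropy_cvg muX.1).
split; first by lra.
move=> hP; have qk : q = kernel_law r g by apply/funext; apply: eq_; lra.
by rewrite -qk.
Qed.

Lemma is_prod_bern_law lam : is_prod_bern rho p lam ->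
  forall m u, lam (cyl m u) = (kernel_law r (fun t => coin p t.2) u)%:E.
Proof.
move=> lamE m u; rewrite lamE invariant_cyl; last by case: sand.
by rewrite -EFinM /bern_cyl big_map.
Qed.

Let coin0 (t : Bool3) : 0 <= coin p t.2. Proof. exact/ltW/coin_gt0. Qed.

Lemma exists_prod_bern : exists lam, is_prod_bern rho p lam.
Proof.
have kl := kernel_law_word_law rl coin0 (@coin_sum R _ p).
have [lam lamE] := word_law_extension kl.
exists lam => m u; rewrite lamE invariant_cyl; last by case: sand.
by rewrite -EFinM /bern_cyl big_map.
Qed.

(** [is_prod_bern] prescribes cylinders only; invariance and the marginal [rho] are recovered from
    uniqueness on cylinders. *)
Lemma prod_bern_image lam mu : is_prod_bern rho p lam -> meq mu (pushforward lam Nmap) ->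
  inM X mu /\ image_law snd (kernel_law r g) (law mu).
Proof.
move=> lamE muE; have lk := is_prod_bern_law lamE.
have lE : law lam = kernel_law r (fun t => coin p t.2).
  by apply/funext => u; rewrite /law lk.
split; last first.
  apply: (image_law_comp (@sandwich_kernel_map R p r)); rewrite -lE.
  exact: (@law_letter_map R Bool3 bool letterN lam mu muE).
have li : invariant lam by apply: cyl_invariant => m u; rewrite !lk.
apply/sand.2; exists lam; split=> //.
have [nu nuE] := prob_image lam (@measurable_letter_map Bool3 Bool2 fst).
move=> B mB; rewrite -[RHS]nuE.
apply: (@meq_law R Bool2 rho nu) => //; first by case: sand.
move=> m u; rewrite -[LHS](fineK (fin_num_cyl nu m u)); congr EFin.
rewrite (@image_cyl R Bool3 Bool2 fst lam nu _ m u) => [|m' v]; last by rewrite nuE.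
apply/esym/(etrans (kernel_law_image r (@coin_sum R _ p) u)); apply: eq_wsum => v _.
by rewrite lk.
Qed.

Lemma prod_bern_lawH mu n : inM X mu -> image_law snd (kernel_law r g) (law mu) ->
  n%:R * (P - integ mu phi) <= lawH (law mu) n.
Proof.
move=> muX ks.
have kl := kernel_law_word_law rl g0 g1; have kr := kernel_law_image r g1.
have dom a : 0 < kernel_law r g [:: a] -> 0 < g a.
  rewrite /kernel_law big_seq1 => h; rewrite lt0r g0 andbT.
  by apply: contraTN h => /eqP ->; rewrite mulr0 ltxx.
have := sandwich_energy kl kr ks dom base_law; rewrite -/Q -/p -/g => eP.
have := kernel_lawH_ge n rl (law_word_law muX.1) g0 g1 ks.
have -> : P = - (\sum_a kernel_law r g [:: a] * log2 (g a)) + \sum_b law mu [:: b] * f b by rewrite eP.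
by rewrite /phi integ_letter addrK mulrN.
Qed.

Lemma prod_bern_entropy mu : inM X mu -> image_law snd (kernel_law r g) (law mu) ->
  P <= entropy mu + integ mu phi.
Proof.
move=> muX ks; rewrite -lerBlDr.
apply: (cvgr_to_ge (entropy_cvg muX.1)); near=> n.
have n0 : (0 < n)%N by near: n; exact: nbhs_infty_gt.
by rewrite ler_pdivlMr ?ltr0n// mulrC prod_bern_lawH.
Unshelve. all: end_near.
Qed.

Lemma prod_bern_equilibrium lam : is_prod_bern rho p lam ->
  forall mu, equilibrium X phi mu <-> meq mu (pushforward lam Nmap).
Proof.
move=> lamE mu; split; last first.
  move=> muE; have [muX ks] := prod_bern_image lamE muE; split=> // nu nuX.
  exact: le_trans (entropy_integ_le nuX).1 (prod_bern_entropy muX ks).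
move=> [muX mumax].
have [nu nuE] := prob_image lam (@measurable_letter_map Bool3 bool letterN).
have nuN : meq nu (pushforward lam Nmap) by move=> B _; exact: nuE.
have [nuX ks] := prod_bern_image lamE nuN.
have [le_ eq_] := entropy_integ_le muX.
have ge_ := le_trans (prod_bern_entropy nuX ks) (mumax nu nuX).
have ms : image_law snd (kernel_law r g) (law mu) by apply: eq_; apply/eqP; rewrite eq_le le_.
have lawE : law mu = law nu by apply/funext => u; rewrite ms ks.
move=> B mB; rewrite -[RHS]nuE; apply: (@meq_law R bool mu nu) => //; first exact: muX.1.
by move=> m u; rewrite lawE; apply: (invariant_cyl nuX.1).
Qed.

(** Gibbs' inequality for the image of [rho (x) B_p] against [gibbs_prob], which is positive on the
    language and so dominates it; the entropy bound holds for each [n]. *)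
Lemma log2_partition_ge n : (0 < n)%N ->
  P <= log2 (partition_fun (in_language X) f n) / n%:R.
Proof.
move=> n0.
have [lam lamE] := exists_prod_bern.
have [mu muE] := prob_image lam (@measurable_letter_map Bool3 bool letterN).
have muN : meq mu (pushforward lam Nmap) by move=> B _; exact: muE.
have [muX ks] := prod_bern_image lamE muN.
have ml := law_word_law muX.1.
have Lne := in_language_ex sX.
have Z0 := partition_fun_gt0 f Lne n.
have [||||u un Q0|le_ _] := @wgibbs R _ n (law mu) (gibbs_prob (in_language X) f n).
- exact: (law_ge0 ml).
- by move=> u; exact: gibbs_prob_ge0.
- exact: law_sum.
- by rewrite gibbs_prob_sum.
- apply: (law_notin_language sX muX); apply/negP => Lu.
  move/eqP: Q0; rewrite /gibbs_prob /gweight Lu gt_eqF// divr_gt0 ?powR_gt0//.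
rewrite ler_pdivlMr ?ltr0n// mulrC.
have := prod_bern_lawH n muX ks.
rewrite /phi integ_letter mulrBr -(law_sum_additive ml).
have : - wsum n (fun u => law mu u * log2 (gibbs_prob (in_language X) f n u)) =
    log2 (partition_fun (in_language X) f n) - wsum n (fun u => law mu u * \sum_(a <- u) f a).
  rewrite -[log2 _]mulr1 -[X in _ * X - _](law_sum ml n) -wsumZ -!wsumN -wsumD.
  apply: eq_wsum => u _; case Lu : (in_language X u).
    by rewrite /gibbs_prob /gweight Lu log2_div ?powR_gt0// log2_powR; ring.
  by rewrite (law_notin_language sX muX) ?Lu//; ring.
by move: le_; rewrite -/(lawH (law mu) n); lra.
Qed.

Lemma log2_partition_le e : 0 < e ->
  \forall n \near \oo, log2 (partition_fun (in_language X) f n) / n%:R <= P + e.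
Proof.
move=> e0; apply: contrapT => nle.
pose D := [set n | P + e <= log2 (partition_fun (in_language X) f n) / n%:R].
(* If the bound fails for arbitrarily large [n], some ultrafilter finer than [\oo] contains [D]; the
   limit measure along it would have free energy at least [P + e]. *)
have PF : ProperFilter (within D \oo).
  apply: Build_ProperFilter => wD0; apply: nle.
  have {}wD0 : \forall n \near \oo, D n -> False := wD0.
  apply: filterS wD0 => n nD; rewrite leNgt; apply/negP => lt_n.
  by apply: nD; rewrite /D /= ltW.
have [U [UU WU]] := ultraFilterLemma PF.
have ooU : \oo `<=` U.
  move=> B oB; have oDB : \forall n \near \oo, D n -> B n by apply: filterS oB => n Bn _.
  exact: WU _ oDB.
have wDD : \forall n \near \oo, D n -> D n by exact: nearW.
have DU : U D := WU _ wDD.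
have [q [ql qL qH]] := limit_law f (in_language_cat sX) (in_language_ex sX) UU ooU.
have [mu muE] := word_law_extension ql.
have mi : invariant mu by apply: cyl_invariant => m u; rewrite !muE.
have lawE : law mu = q by apply/funext => u; rewrite /law muE.
have muX : inM X mu by apply: inM_law => // u uL; rewrite lawE qL.
have [le_ _] := entropy_integ_le muX.
have : P + e - \sum_a q [:: a] * f a <= entropy mu.
  apply: (cvgr_to_ge (entropy_cvg mi)); near=> n.
  have n0 : (0 < n)%N by near: n; exact: nbhs_infty_gt.
  rewrite ler_pdivlMr ?ltr0n// mulrC lawE; apply: qH.
  exact: DU.
by move: le_; rewrite /phi integ_letter lawE; lra.
Unshelve. all: end_near.
Qed.

Lemma sandwich_pressure_cvg :
  log2 (partition_fun (in_language X) f n) / n%:R @[n --> \oo] --> P.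
Proof.
apply/cvgrPdist_le => e e0; near=> n.
have n0 : (0 < n)%N by near: n; exact: nbhs_infty_gt.
have le_ : log2 (partition_fun (in_language X) f n) / n%:R <= P + e.
  by near: n; exact: log2_partition_le.
rewrite distrC ger0_norm ?subr_ge0 ?log2_partition_ge//.
by rewrite lerBlDl.
Unshelve. all: end_near.
Qed.

Lemma sandwich_pressure : pressure X phi = P.
Proof.
rewrite /pressure -(cvg_lim _ sandwich_pressure_cvg)//.
by congr (limn _); apply/funext => n; rewrite -(pressure_term sX).
Qed.

End Sandwich.

Unset Implicit Arguments.

Theorem theorem5p4 (R : realType) (X : set (int -> bool))
  (rho : probability (ShiftSpace Bool2) R) :
  subshift X -> sandwich X rho -> base_measure rho -> entropy rho = 0 ->
  (forall f : bool -> R,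
    let phi := fun x : int -> bool => f (x 0) in
    let p := (2 : R) `^ f false / ((2 : R) `^ f false + (2 : R) `^ f true) in
    [/\ pressure X phi =
          rho2 rho false false * f false + rho2 rho true true * f true +
          rho2 rho false true * log2 ((2 : R) `^ f false + (2 : R) `^ f true),
        exists lam, is_prod_bern rho p lam &
        forall lam, is_prod_bern rho p lam ->
          forall mu, equilibrium X phi mu <-> meq mu (pushforward lam Nmap)]) /\
  [/\ htop X = rho2 rho false true,
      rho2 rho false true =
        fine (pushforward rho sndm (cyl 0 [:: true])) -
        fine (pushforward rho fstm (cyl 0 [:: true])),
      intrinsically_ergodic (R := R) X &
      forall lam, is_prod_bern rho (1 / 2) lam ->
        forall mu, mme X mu <-> meq mu (pushforward lam Nmap)].
Proof.
move=> sX sand base h0; split=> [f phi p|].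
  split; first exact: sandwich_pressure.
  - exact: (exists_prod_bern sand f).
  - exact: (prod_bern_equilibrium sand base h0).
pose f0 (b : bool) : R := 0.
have p0 : 2 `^ f0 false / (2 `^ f0 false + 2 `^ f0 true) = 1 / 2 :> R.
  by rewrite /f0 powRr0.
(* For the zero potential free energy is entropy, and the coin is fair. *)
have mmeE mu : mme X mu <-> equilibrium X (fun x => f0 (x 0)) mu.
  have i0 nu : integ nu (fun x => f0 (x 0)) = 0.
    by rewrite integ_letter big1// => b _; rewrite mulr0.
  by split=> -[muX mumax]; split=> // nu /mumax; rewrite !i0 !addr0.
have mme_prod lam : is_prod_bern rho (1 / 2) lam ->
    forall mu, mme X mu <-> meq mu (pushforward lam Nmap).
  by rewrite -p0 => lamE mu; rewrite mmeE; exact: (prod_bern_equilibrium sand base h0 lamE).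
have [lam lamE] := exists_prod_bern sand f0; rewrite p0 in lamE.
split=> //.
- have cv := sandwich_pressure_cvg sX sand base h0 (f := f0).
  transitivity (limn (fun n => log2 (partition_fun (in_language X) f0 n) / n%:R)).
    congr (limn _); apply/funext => n; congr (log2 _ / _).
    rewrite /partition_fun /wsum -sum1_card natr_sum big_mkcond /=.
    apply: eq_bigr => u _; rewrite unfold_in /= (inL_language X) /gweight.
    by case: ifP => // _; rewrite big1 ?powRr0.
  rewrite (cvg_lim _ cv)// /f0 powRr0 !mulr0 !add0r.
  by rewrite (_ : 1 + 1 = 2)// log22 mulr1.
- have [nu1 nu1E] := prob_image rho (@measurable_letter_map Bool2 bool fst).
  have [nu2 nu2E] := prob_image rho (@measurable_letter_map Bool2 bool snd).
  have m1 : image_law fst (law rho) (law nu1).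
    by apply: law_letter_map => B _; exact: nu1E.
  have m2 : image_law snd (law rho) (law nu2).
    by apply: law_letter_map => B _; exact: nu2E.
  transitivity (law nu2 [:: true] - law nu1 [:: true]); last first.
    by congr (_ - _); [exact: (congr1 fine (nu2E _))|exact: (congr1 fine (nu1E _))].
  (* Both marginals contain [rho(1,1)], which cancels, and [rho(1,0) = 0]. *)
  rewrite (image_fst1 _ m1) (image_snd1 _ m2) !big_bool /= (base_law base).
  by rewrite /rho2 /law; ring.
- split.
    have [mu muE] := prob_image lam (@measurable_letter_map Bool3 bool (fun t => if t.2 then t.1.2 else t.1.1)).
    by exists mu; apply/(mme_prod lam lamE) => B _; exact: muE.
  move=> mu nu /(mme_prod lam lamE) muE /(mme_prod lam lamE) nuE B mB.
  by rewrite muE// nuE.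
Qed.
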